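(* For any integers $d,n\ge2$, the complex varieties $Rat^*_{d,n}(\mathbb{C})$ and $Poly^{d(n+1),1}_{n+1}(\mathbb{C})$ are not isomorphic.
   Context: $Rat^*_{d,n}$ is the variety of degree $d$ pointed regular maps $\mathbb{P}^1\to\mathbb{P}^n$ over $\mathbb{C}$ (maps sending $\infty$ to a fixed base point, $[1:\cdots:1]$). It is identified with the variety of $(n+1)$-tuples $(f_0,\ldots,f_n)$ of monic degree $d$ polynomials in one variable over $\mathbb{C}$ which share no common root, an open subvariety of $\mathbb{A}^{d(n+1)}$ (coordinates: the coefficients of the $f_i$). $Poly^{d(n+1),1}_{n+1}$ is the variety of monic degree $d(n+1)$ polynomials in one variable over $\mathbb{C}$ with no root of multiplicity at least $n+1$, an open subvariety of $\mathbb{A}^{d(n+1)}$ (coordinates: the coefficients). *)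

(* Defs.v *)
From HB Require Import structures.
From mathcomp Require Import all_boot all_order all_algebra.
From mathcomp Require Import classical_sets reals complex mpoly.

Set Implicit Arguments.
Unset Strict Implicit.
Unset Printing Implicit Defensive.

Import GRing.Theory.

Local Open Scope classical_set_scope.
Local Open Scope ring_scope.

(* Points of the affine space A^N over K are row vectors 'rV[K]_N, and
   p.@[x 0] is the value of the polynomial p at the point x.               *)
Section QuasiAffine.
Variable K : fieldType.

Definition zero_locus N (S : set {mpoly K[N]}) : set 'rV[K]_N :=
  [set x | forall p, S p -> p.@[x 0] = 0].

Definition zariski_closed N (Z : set 'rV[K]_N) : Prop :=
  exists S : set {mpoly K[N]}, Z = zero_locus S.

Definition zariski_open N (O : set 'rV[K]_N) : Prop := zariski_closed (~` O).

Definition open_in N (X U : set 'rV[K]_N) : Prop :=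
  exists2 O, zariski_open O & U = X `&` O.

(* In regular_on, morphism and isomorphic, functions are total on the ambient
   affine space; only their values on the indicated domain matter.         *)
Definition regular_on N (U : set 'rV[K]_N) (f : 'rV[K]_N -> K) : Prop :=
  forall x, U x -> exists O : set 'rV[K]_N, [/\ zariski_open O, O x &
    exists p q : {mpoly K[N]}, forall y, (U `&` O) y ->
      q.@[y 0] != 0 /\ f y = p.@[y 0] / q.@[y 0]].

Definition morphism N M (X : set 'rV[K]_N) (Y : set 'rV[K]_M)
    (phi : 'rV[K]_N -> 'rV[K]_M) : Prop :=
  [/\ forall x, X x -> Y (phi x),
      forall V, open_in Y V -> open_in X (X `&` phi @^-1` V) &
      forall V f, open_in Y V -> regular_on V f ->
        regular_on (X `&` phi @^-1` V) (f \o phi)].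

Definition isomorphic N M (X : set 'rV[K]_N) (Y : set 'rV[K]_M) : Prop :=
  exists (phi : 'rV[K]_N -> 'rV[K]_M) (psi : 'rV[K]_M -> 'rV[K]_N),
    [/\ morphism X Y phi, morphism Y X psi,
        forall x, X x -> psi (phi x) = x &
        forall y, Y y -> phi (psi y) = y].

(* The monic polynomial of degree m with lower coefficients v 0 0, v 0 1, ... *)
Definition monic_of m (v : 'rV[K]_m) : {poly K} := 'X^m + rVpoly v.

(* The j-th lower coefficient of f_i is the (i, j) entry of vec_mx u.       *)
Definition Rat_var (d n : nat) : set 'rV[K]_(n.+1 * d) :=
  [set u | ~ exists z : K,
     forall i : 'I_n.+1, root (monic_of (row i (vec_mx u))) z].

Definition Poly_var (m k : nat) : set 'rV[K]_m :=
  [set v | ~ exists z : K, (k <= mup z (monic_of v))%N].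

End QuasiAffine.

Arguments Rat_var K d n : clear implicits.
Arguments Poly_var K m k : clear implicits.

(* Main.v *)
(** Let R be the set of tuples with a common root and D the set of polynomials
    with a root of multiplicity at least n + 1.  Both have codimension n >= 2,
    so by Hartogs an isomorphism between their complements extends to mutually
    inverse polynomial maps of the affine spaces, and these exchange R and D.
    Hence they match the Zariski tangent spaces of R and D.

    At a point ((X - z) g_i) of R the tangent space is everything if the g_i
    have a common root (two branches of R meet transversally there, or the point
    is a limit of such points), and has codimension n otherwise.  At the point
    X^(n+2) h of D, where h is separable with h(0) <> 0, the set D is locally a
    smooth factor times the curve (t^2, t^3, ..., t^(n+2)); its tangent space is
    proper, but contains all multiples of X^(n-1), so its codimension is at most
    n - 1.  No point of R has such a tangent space. *)

Require Import Defs.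
From mathcomp Require Import all_boot all_order all_algebra fingroup perm.
From mathcomp Require Import classical_sets boolp reals complex mpoly.
From mathcomp Require Import ring zify.

Set Implicit Arguments.
Unset Strict Implicit.
Unset Printing Implicit Defensive.

Import Order.TTheory GRing.Theory Num.Theory.

Local Open Scope ring_scope.

(** * The gradient of a polynomial function *)

Section Prelim.

(** No ideal of R or D is computed. A vector is tangent at x when [grad G x] kills it for every G
    vanishing on the set: curves inside the set produce tangent vectors, explicit equations exclude
    others, and composition carries equations through the polynomial maps. Codimension two is
    encoded by a polynomial law in a point x and a direction v whose nonvanishing forces the whole
    line x + t v into the complement. Along such a line a regular function is a rational function of
    one variable without poles, hence a polynomial.

    The multiplicity n + 2 is the first degeneration of D. Where one root has multiplicity n + 1 and
    the others are simple, D is smooth of codimension n, just like R at a simple common root; the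
    collision with one more root lowers the tangent codimension without making it 0, and R has no
    such intermediate stage. The obstacle is to show that it does not become 0: an equation of D
    must be polynomial in the coefficients, yet see only the n + 2 colliding roots. It is obtained
    by summing over all sets of n + 2 roots, with a weight that is small at the cusp for every other
    set. *)

Lemma rmorph_mmap n (L : nzRingType) (S T : comNzRingType)
    (f : {rmorphism L -> S}) (g : {rmorphism S -> T}) h (p : {mpoly L[n]}) :
  g (mmap f h p) = mmap (g \o f) (g \o h) p.
Proof.
rewrite /mmap rmorph_sum; apply: eq_bigr => m _; rewrite rmorphM /mmap1.
by rewrite rmorph_prod; congr (_ * _); apply: eq_bigr => i _; rewrite rmorphXn.
Qed.

Lemma eq_mmap n (L S : nzRingType) (f g : L -> S) (h k : 'I_n -> S) :
  f =1 g -> h =1 k -> mmap f h =1 mmap g k.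
Proof.
move=> fg hk p; rewrite /mmap; apply: eq_bigr => m _.
by rewrite fg (mmap1_eq _ hk).
Qed.

Lemma mpoly_gen_ind n (L : nzRingType) (P : {mpoly L[n]} -> Prop) :
  (forall c, P c%:MP) -> (forall i, P 'X_i) ->
  (forall p q, P p -> P q -> P (p + q)) ->
  (forall p q, P p -> P q -> P (p * q)) -> forall p, P p.
Proof.
move=> PC PX PD PM; elim/mpolyind => [|c m p _ _ Pp].
  by rewrite -[0]/(mpolyC n 0) ?mpolyC0; have := PC 0; rewrite mpolyC0.
apply: (PD) => //; rewrite -mul_mpolyC; apply: (PM) => //.
have P1 : P 1 by rewrite -mpolyC1; exact: PC.
rewrite mpolyXE_id; apply: (big_ind P) => // i _.
by elim: (m i) => [|k IH]; rewrite ?expr0 ?exprS //; apply: PM.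
Qed.

Variable K : numFieldType.

Lemma horner_eq_poly (p q : {poly K}) : (forall t, p.[t] = q.[t]) -> p = q.
Proof.
move=> pq; apply/eqP; rewrite -subr_eq0; apply: contraT => nz.
pose s : seq K := [seq i%:R | i <- iota 0 (size (p - q))].
have us : uniq s.
  rewrite map_inj_uniq ?iota_uniq // => i j /eqP.
  by rewrite eqr_nat => /eqP.
have /(max_poly_roots nz)/(_ us) : all (root (p - q)) s.
  by apply/allP => x _; rewrite rootE hornerD hornerN pq subrr.
by rewrite size_map size_iota ltnn.
Qed.

Definition grad n (G : {mpoly K[n]}) (x v : 'rV[K]_n) : K :=
  \sum_i v 0 i * (G^`M(i)).@[x 0].

Lemma taylor1 n (G : {mpoly K[n]}) (x : 'rV[K]_n) (e : 'I_n -> {poly K}) k :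
  exists h, mmap polyC (fun i => (x 0 i)%:P + 'X^k * e i) G =
    (G.@[x 0])%:P + 'X^k * (\sum_i e i * ((G^`M(i)).@[x 0])%:P)
      + 'X^k * 'X^k * h.
Proof.
elim/mpoly_gen_ind: G => [c|i|p q [hp Ep] [hq Eq]|p q [hp Ep] [hq Eq]].
- exists 0; rewrite mmapC mevalC big1 ?mulr0 ?addr0 // => i _.
  by rewrite mderivC meval0 mulr0.
- exists 0; rewrite mmapX mmap1U mevalXU mulr0 addr0; congr (_ + _ * _).
  rewrite (bigD1 i) //= big1 ?addr0.
    rewrite mderivX mnm1E eqxx scale1r (_ : (_ - _)%MM = 0%MM).
      by rewrite mpolyX0 meval1 mulr1.
    by apply/mnmP => j; rewrite mnmBE subnn mnm0E.
  move=> j ji; rewrite mderivX mnm1E eq_sym (negPf ji) scale0r meval0 mulr0 //.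
- exists (hp + hq); rewrite rmorphD /= Ep Eq mevalD polyCD.
  have -> : \sum_i e i * (((p + q)^`M(i)).@[x 0])%:P =
      \sum_i e i * ((p^`M(i)).@[x 0])%:P + \sum_i e i * ((q^`M(i)).@[x 0])%:P.
    by rewrite -big_split; apply: eq_bigr => i _; rewrite mderivD mevalD polyCD mulrDr.
  ring.
- set Sp := (\sum_i _) in Ep; set Sq := (\sum_i _) in Eq.
  exists ((p.@[x 0])%:P * hq + Sp * Sq + 'X^k * Sp * hq
    + hp * ((q.@[x 0])%:P + 'X^k * Sq + 'X^k * 'X^k * hq)).
  rewrite rmorphM /= Ep Eq mevalM polyCM.
  have -> : \sum_i e i * (((p * q)^`M(i)).@[x 0])%:P =
      Sp * (q.@[x 0])%:P + (p.@[x 0])%:P * Sq.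
    rewrite mulr_suml mulr_sumr -big_split /=; apply: eq_bigr => i _.
    rewrite mderivM mevalD !mevalM polyCD !polyCM mulrDr !mulrA.
    by congr (_ + _); rewrite [e i * _]mulrC -!mulrA.
  ring.
Qed.


Definition vanishes_on n (X : set 'rV[K]_n) (G : {mpoly K[n]}) : Prop :=
  forall x, X x -> G.@[x 0] = 0.

Lemma mmap_polyC_horner n (G : {mpoly K[n]}) (e : 'I_n -> {poly K}) t :
  (mmap polyC e G).[t] = G.@[fun i => (e i).[t]].
Proof.
rewrite -[LHS]/(horner_eval t _) rmorph_mmap /meval.
by apply: eq_mmap => // c /=; rewrite /horner_eval hornerC.
Qed.

(** The remainder in [taylor1] starts at t^(2k), so all coefficients of the curve in orders k to 2k
    - 1 are tangent, not only the leading one. The outer variable of [B] is the curve parameter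
    t. *)
Lemma vanishes_curve M (X : set 'rV[K]_M) (G : {mpoly K[M]}) (x : 'rV[K]_M)
    (B : {poly {poly K}}) k j :
  vanishes_on X G ->
  (forall t, X (x + t ^+ k *: poly_rV B.[t%:P])) -> (j < k)%N ->
  grad G x (poly_rV B`_j) = 0.
Proof.
move=> GX cX jk; pose e (i : 'I_M) := map_poly (coefp i) B.
have eE i t : (e i).[t] = (B.[t%:P])`_i.
  rewrite (horner_coef_wide _ (size_poly _ _)) horner_coef coef_sum.
  by apply: eq_bigr => l _; rewrite coef_map_id0 /= ?coef0 // -polyC_exp coefMC.
have [h Eh] := taylor1 G x e k.
have E0 : mmap polyC (fun i => (x 0 i)%:P + 'X^k * e i) G = 0.
  apply: horner_eq_poly => t; rewrite mmap_polyC_horner horner0 -[RHS](GX _ (cX t)).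
  by apply: meval_eq => i; rewrite !mxE !hornerE eE.
have G0 : G.@[x 0] = 0.
  have k0 : (0 < k)%N by apply: leq_ltn_trans jk.
  by apply: GX; have := cX 0; rewrite expr0n eqn0Ngt k0 scale0r addr0.
move: Eh; rewrite E0 G0 add0r -mulrA -mulrDr => /esym/eqP.
rewrite mulf_eq0 expf_eq0 polyX_eq0 andbF /= => /eqP /(congr1 (fun p : {poly K} => p`_j)).
rewrite coefD coefXnM jk addr0 coef0 coef_sum => E; rewrite /grad -[RHS]E.
by apply: eq_bigr => i _; rewrite coefMC coef_map_id0 /= ?coef0 // mxE.
Qed.

Lemma grad_line_eq0 n (X : set 'rV[K]_n) (G : {mpoly K[n]}) (x v : 'rV[K]_n) :
  vanishes_on X G -> (forall t, X (x + t *: v)) -> grad G x v = 0.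
Proof.
move=> GX lX; rewrite -[v]rVpolyK -[rVpoly v](coefC (rVpoly v) 0).
by apply: (vanishes_curve (k := 1) GX) => // t; rewrite hornerC rVpolyK expr1.
Qed.

Lemma grad_delta n (G : {mpoly K[n]}) x i :
  grad G x (delta_mx 0 i) = (G^`M(i)).@[x 0].
Proof.
rewrite /grad (bigD1 i) //= big1 ?addr0; first by rewrite mxE !eqxx mul1r.
by move=> j ji; rewrite mxE eqxx (negPf ji) mul0r.
Qed.

Lemma grad_is_linear n (G : {mpoly K[n]}) x a u v :
  grad G x (a *: u + v) = a * grad G x u + grad G x v.
Proof.
rewrite /grad mulr_sumr -big_split; apply: eq_bigr => i _.
by rewrite !mxE mulrDl mulrA.
Qed.

Lemma vanishes_mderiv n (G : {mpoly K[n]}) i :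
  vanishes_on setT G -> vanishes_on setT (G^`M(i)).
Proof. by move=> G0 x _; rewrite -grad_delta (grad_line_eq0 G0). Qed.

(** All partial derivatives vanish everywhere too, and the value at 0 of the derivative of
    multi-order m is the coefficient of m times a product of factorials, nonzero in characteristic
    zero. *)
Lemma mpoly_fun_eq0 n (G : {mpoly K[n]}) : vanishes_on setT G -> G = 0.
Proof.
move=> G0; apply/mpolyP => m; rewrite mcoeff0.
have : vanishes_on setT (G^`M[m]).
  rewrite mderivm_foldr; elim: (flatten _) => //= i s IH.
  exact: vanishes_mderiv.
have coef0 (H : {mpoly K[n]}) : vanishes_on setT H -> H@_0 = 0.
  move=> /(_ 0 Logic.I); suff -> : H.@[(0 : 'rV[K]_n) 0] = H@_0 by [].
  elim/mpoly_gen_ind: H => [c|i|p q IHp IHq|p q IHp IHq].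
  - by rewrite mevalC mcoeffC eqxx mulr1.
  - by rewrite mevalXU mxE mcoeffX mnm1_eq0.
  - by rewrite mevalD mcoeffD IHp IHq.
  - by rewrite mevalM IHp IHq -[LHS]/(mcoeff 0 p * mcoeff 0 q) -rmorphM.
move/coef0/eqP; rewrite mcoeff_mderivm addm0 mulrn_eq0 => /orP[|/eqP //].
rewrite (eq_bigr (fun i => (m i)`!)) => [|i _]; last by rewrite ffactnn.
by rewrite -[_ == _]negbK -lt0n prodn_gt0 // => i; rewrite fact_gt0.
Qed.

End Prelim.

(** * Regular functions on the complement of a set of codimension two *)

(* A polynomial function of a point and a direction, given over all
   commutative rings at once so that it can be evaluated at generic points. *)
Definition line_law n := forall L : comNzRingType, 'rV[L]_n -> 'rV[L]_n -> L.

Definition natural_law n (S : line_law n) :=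
  forall (L L' : comNzRingType) (f : {rmorphism L -> L'}) x v,
    f (S L x v) = S L' (map_mx f x) (map_mx f v).

Section Hartogs.
Variables (K : numClosedFieldType) (n : nat).
Implicit Types (p q : {mpoly K[n]}) (x y v : 'rV[K]_n) (X O : set 'rV[K]_n).

Lemma zariski_nbhd O x : zariski_open O -> O x ->
  exists2 o : {mpoly K[n]}, o.@[x 0] != 0 & forall y, o.@[y 0] != 0 -> O y.
Proof.
move=> [S ES] Ox; have : ~ zero_locus S x by rewrite -ES => /(_ Ox).
move=> /existsNP[p] /not_implyP[Sp /eqP px0]; exists p => // y py0.
apply: contrapT => nOy; have : zero_locus S y by rewrite -ES.
by move=> /(_ p Sp) py; rewrite py eqxx in py0.
Qed.

Lemma mpoly_fun_neq0 p : p != 0 -> exists x, p.@[x 0] != 0.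
Proof.
move=> p0; apply: contrapT => /forallNP H; move/eqP: p0; apply.
by apply: mpoly_fun_eq0 => x _; apply/eqP/negP => /negP /(H x).
Qed.

(** Each c / d is a form of b / a that is regular at t. If the reduced denominator of b / a had a
    root t, the reduced numerator would share it, because d does not vanish there. *)
Lemma dvdp_local (a b : {poly K}) : a != 0 ->
  (forall t, exists c d, a * c = b * d /\ d.[t] != 0) -> a %| b.
Proof.
move=> a0 loc; set g := gcdp a b.
have g0 : g != 0 by rewrite gcdp_eq0 negb_and a0.
have [Ea Eb] : a = a %/ g * g /\ b = b %/ g * g.
  by rewrite !divpK ?dvdp_gcdl ?dvdp_gcdr.
have cop : coprimep (a %/ g) (b %/ g) by rewrite coprimep_div_gcd ?a0.
rewrite Ea Eb dvdp_mul2r // (@eqp_dvdl _ 1) ?dvd1p //.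
rewrite -size_poly_eq1; apply: contraT => /closed_rootP[t rt].
have [c [d [E dt]]] := loc t; have := coprimep_root cop rt.
rewrite Ea Eb ![_ * g]mulrC -!mulrA in E.
move/(mulfI g0)/(congr1 (horner_eval t)): E.
rewrite /horner_eval !hornerM (rootP rt) mul0r => /esym/eqP.
by rewrite mulf_eq0 (negPf dt) orbF => ->.
Qed.

(** The polynomial p(x + t v) in t at the generic point x. *)
Definition taylor_line v p : {poly {mpoly K[n]}} :=
  mmap (polyC \o @mpolyC n K) (fun i => ('X_i)%:P + (v 0 i)%:MP%:P * 'X) p.

Lemma taylor_lineM v : {morph taylor_line v : p q / p * q}.
Proof. exact: rmorphM. Qed.

Lemma taylor_line0 v p : (taylor_line v p).[0] = p.
Proof.
rewrite -[LHS]/(horner_eval 0 _) /taylor_line rmorph_mmap /=.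
rewrite -[RHS](comp_mpoly_id p) /comp_mpoly; apply: eq_mmap => [c|i] /=.
  by rewrite /horner_eval hornerC.
by rewrite /horner_eval !hornerE tnth_mktuple.
Qed.

Lemma taylor_lineE v p x t :
  (map_poly (meval (x 0)) (taylor_line v p)).[t] = p.@[(x + t *: v) 0].
Proof.
rewrite -[LHS]/(horner_eval t _) /taylor_line !rmorph_mmap /=.
rewrite [RHS]/meval; apply: eq_mmap => [c|i] /=.
  by rewrite /horner_eval map_polyC hornerC /= mevalC.
rewrite /horner_eval rmorphD rmorphM /= !map_polyC map_polyX /= !hornerE.
by rewrite mevalXU mevalC !mxE mulrC.
Qed.

Lemma taylor_line_eqM v x p q p' q' : q * p' = p * q' ->
  let ev r := map_poly (meval (x 0)) (taylor_line v r) in ev q * ev p' = ev p * ev q'.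
Proof.
move=> E ev.
have H : taylor_line v q * taylor_line v p' = taylor_line v p * taylor_line v q'.
  exact: etrans (esym (taylor_lineM v q p')) (etrans (congr1 _ E) (taylor_lineM v p q')).
have evM a b : map_poly (meval (x 0)) (a * b) =
    map_poly (meval (x 0)) a * map_poly (meval (x 0)) b by rewrite rmorphM.
exact: etrans (esym (evM _ _)) (etrans (congr1 _ H) (evM _ _)).
Qed.

Definition top_form p : {mpoly K[n]} :=
  \sum_(m <- msupp p | mdeg m == (msize p).-1) p@_m *: 'X_[m].

Lemma top_form_neq0 p : p != 0 -> top_form p != 0.
Proof.
move=> p0; apply: contraNneq (p0) => E; rewrite -mleadc_eq0.
move: E => /(congr1 (mcoeff (mlead p))); rewrite mcoeff0 raddf_sum /=.
rewrite big_mkcond (bigD1_seq (mlead p)) ?msupp_uniq ?mlead_supp //=.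
rewrite -mlead_deg // eqxx mcoeffZ mcoeffX eqxx mulr1 big1 ?addr0 => [->//|].
by move=> m mp; rewrite mcoeffZ mcoeffX (negPf mp) mulr0 if_same.
Qed.

Lemma coefM_top (L : nzRingType) (a b : {poly L}) i j :
  (size a <= i.+1)%N -> (size b <= j.+1)%N ->
  (size (a * b)%R <= (i + j).+1)%N /\ (a * b)`_(i + j) = a`_i * b`_j.
Proof.
move=> sa sb; split.
  apply: leq_trans (size_polyMleq _ _) _.
  by rewrite -ltnS; case: (size a + size b)%N (leq_add sa sb) => //= k; rewrite addSn addnS.
rewrite coefM (bigD1 (inord i)) //= inordK ?ltnS ?leq_addr // addKn big1 ?addr0 // => k ki.
have [lt|] := ltnP i k; first by rewrite [a`__]nth_default ?mul0r // (leq_trans sa).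
rewrite leq_eqVlt => /orP[/eqP E|lt].
  by case/eqP: ki; apply: val_inj; rewrite /= inordK ?ltnS ?leq_addr.
by rewrite [b`__]nth_default ?mulr0 // (leq_trans sb) // ltn_subRL ltn_add2r.
Qed.

Lemma taylor_line_monom v (m : 'X_{1..n}) :
  (size (taylor_line v 'X_[m]) <= (mdeg m).+1)%N /\
  (taylor_line v 'X_[m])`_(mdeg m) = (('X_[m] : {mpoly K[n]}).@[v 0])%:MP.
Proof.
rewrite /taylor_line mmapX mevalX mdegE rmorph_prod /= /mmap1.
elim/big_ind3: _ => [|a i b a' i' b' [sa ca] [sb cb]|i _].
- by rewrite size_poly1 coef1.
- by have [? ->] := coefM_top sa sb; rewrite ca cb.
elim: (m i) => [|k [sk ck]]; first by rewrite !expr0 size_poly1 coef1.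
rewrite !exprS; set l := (X in X * _).
have sl : (size l <= 2)%N.
  rewrite (leq_trans (size_polyD _ _)) // geq_max (leq_trans (size_polyC_leq1 _)) //.
  by rewrite (leq_trans (size_polyMleq _ _)) // size_polyX addn2 /= ltnS size_polyC_leq1.
have [? E] := coefM_top sl sk; rewrite -[k.+1]/(1 + k)%N E; split=> //.
by rewrite ck rmorphM coefD coefC coefMX coefC /= add0r.
Qed.

Lemma taylor_line_sum v p : taylor_line v p =
  \sum_(m <- msupp p) (p@_m)%:MP%:P * taylor_line v 'X_[m].
Proof. by apply: eq_bigr => m _; rewrite /taylor_line mmapX. Qed.

Lemma size_taylor_line v p : (size (taylor_line v p) <= msize p)%N.
Proof.
rewrite taylor_line_sum big_seq; elim/big_ind: _ => [|a b sa sb|m mp].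
- by rewrite size_poly0.
- by rewrite (leq_trans (size_polyD _ _)) // geq_max sa.
rewrite mul_polyC (leq_trans (size_scale_leq _ _)) //.
by rewrite (leq_trans (taylor_line_monom v m).1) // msize_mdeg_lt.
Qed.

(** This coefficient does not depend on x. For v off the zeros of [top_form p] it is a nonzero
    constant, so dividing by p(x + t v) introduces only constant denominators and specialising x
    keeps the degree. *)
Lemma coef_taylor_line v p :
  (taylor_line v p)`_(msize p).-1 = ((top_form p).@[v 0])%:MP.
Proof.
rewrite taylor_line_sum coef_sum /top_form.
rewrite (big_mkcond (fun m => _ == _) (fun m => p@_m *: 'X_[m])).
rewrite (raddf_sum (meval (v 0))) (raddf_sum (@mpolyC n K)).
rewrite [RHS]big_seq [LHS]big_seq.
apply: eq_bigr => m /msize_mdeg_lt mp; have [sm cm] := taylor_line_monom v m.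
rewrite coefCM; case: eqVneq => [<-|ne]; first by rewrite cm [in RHS]/= mevalZ mpolyCM.
rewrite /= meval0 mpolyC0 nth_default ?mulr0 // (leq_trans sm) // ltn_neqAle ne /=.
by rewrite -ltnS prednK // (leq_ltn_trans _ mp).
Qed.

(* Otherwise unification unfolds the sum in [mmap] and does not return. *)
Opaque taylor_line.

(** A fraction p / q representing f near one point is restricted to the lines in one direction v. On
    a line inside [X] it has no poles, so q(x + t v) divides p(x + t v) for generic x, and the
    quotient at t = 0 is the polynomial sought, up to a constant. *)
Lemma hartogs (S : line_law n) X x0 v0 (f : 'rV[K]_n -> K) :
  natural_law S -> S K x0 v0 != 0 ->
  (forall x v, S K x v != 0 -> forall t, X (x + t *: v)) ->
  regular_on X f ->
  exists p, forall x, X x -> f x = p.@[x 0].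
Proof.
move=> Snat S0 SX reg.
pose sv v := S {mpoly K[n]} (\row_i 'X_i) (map_mx (@mpolyC n K) v).
have svE v x : (sv v).@[x 0] = S K x v.
  rewrite [LHS](Snat _ _ (meval (x 0))) -map_mx_comp; congr S.
    by apply/rowP => i; rewrite !mxE /= mevalXU.
  by apply/rowP => i; rewrite !mxE /= mevalC.
have sX x v : S K x v != 0 -> X x by move=> /SX/(_ 0); rewrite scale0r addr0.
have loc x : X x -> exists o p q : {mpoly K[n]}, [/\ o != 0, q.@[x 0] != 0, o.@[x 0] != 0 &
   forall y, X y -> o.@[y 0] != 0 -> q.@[y 0] != 0 /\ f y = p.@[y 0] / q.@[y 0]].
  move=> Xx; have [O [Oo Ox [p [q H]]]] := reg x Xx.
  have [o ox oO] := zariski_nbhd Oo Ox.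
  have [qx _] := H x (conj Xx Ox).
  exists o, p, q; split=> //; first by apply: contraNneq ox => ->; rewrite meval0.
  by move=> y Xy /oO Oy; apply: H.
have s0n0 : sv v0 != 0.
  by apply: contraNneq S0 => E; rewrite -svE E meval0.
have [o [p [q [on0 qx0 _ H]]]] := loc x0 (sX _ _ S0).
have q0 : q != 0 by apply: contraNneq qx0 => ->; rewrite meval0.
(* Two local fractions agree wherever [o], [o'] and the law are all nonzero, hence as rational
   functions. *)
have glue o' p' q' : o' != 0 ->
    (forall y, X y -> o'.@[y 0] != 0 -> q'.@[y 0] != 0 /\ f y = p'.@[y 0] / q'.@[y 0]) ->
    q * p' = p * q'.
  move=> o'n0 H'; apply/eqP; rewrite -subr_eq0.
  have : (q * p' - p * q') * (o * o' * sv v0) == 0.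
    apply/eqP/mpoly_fun_eq0 => y _; rewrite !mevalM mevalB !mevalM.
    have [->|oy] := eqVneq o.@[y 0] 0; first by rewrite mul0r mul0r mulr0.
    have [->|o'y] := eqVneq o'.@[y 0] 0; first by rewrite mulr0 mul0r mulr0.
    have [->|sy] := eqVneq (sv v0).@[y 0] 0; first by rewrite !mulr0.
    rewrite svE in sy; have Xy := sX _ _ sy.
    have [qy Ef] := H y Xy oy; have [q'y Ef'] := H' y Xy o'y.
    have : p.@[y 0] / q.@[y 0] = p'.@[y 0] / q'.@[y 0] by rewrite -Ef.
    move=> /eqP; rewrite eqr_div // => /eqP ->.
    by rewrite [q.@[_] * _]mulrC subrr mul0r.
  by rewrite !mulf_eq0 (negPf on0) (negPf o'n0) (negPf s0n0) !orbF => /eqP->.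
(* On the line of directions joining [v1], good for the top form, to [v0], good for the law, both
   conditions are nonzero polynomials in t, and so is their product. *)
have [v Sv tv] : exists2 v, S K x0 v != 0 & (top_form q).@[v 0] != 0.
  have [v1 tv1] := mpoly_fun_neq0 (top_form_neq0 q0).
  pose s1 := S {poly K} (map_mx polyC x0) (map_mx polyC v1 + 'X *: map_mx polyC (v0 - v1)).
  pose t1 := mmap polyC (fun i => (v1 0 i)%:P + 'X * ((v0 - v1) 0 i)%:P) (top_form q).
  have s1E t : s1.[t] = S K x0 (v1 + t *: (v0 - v1)).
    rewrite -[LHS]/(horner_eval t _) [LHS]Snat; congr S; apply/rowP => i.
      by rewrite !mxE /= /horner_eval hornerC.
    by rewrite !mxE /= /horner_eval !hornerE.
  have t1E t : t1.[t] = (top_form q).@[(v1 + t *: (v0 - v1)) 0].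
    by rewrite mmap_polyC_horner; apply: meval_eq => i; rewrite !mxE !hornerE.
  have s1n0 : s1 != 0.
    by apply: contraNneq S0 => E; have := s1E 1; rewrite E horner0 scale1r addrC subrK => <-.
  have t1n0 : t1 != 0.
    by apply: contraNneq tv1 => E; have := t1E 0; rewrite E horner0 scale0r addr0 => <-.
  have [t] : exists t, (s1 * t1).[t] != 0.
    apply: contrapT => /forallNP E; have /eqP := mulf_neq0 s1n0 t1n0; apply.
    by apply: horner_eq_poly => t; rewrite horner0; apply/eqP/negP => /negP/(E t).
  rewrite hornerM mulf_eq0 negb_or s1E t1E => /andP[? ?].
  by exists (v1 + t *: (v0 - v1)).
set P := taylor_line v p; set Q := taylor_line v q.
have sQ : size Q = msize q.
  apply/eqP; rewrite eqn_leq size_taylor_line /=.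
  have : Q`_(msize q).-1 != 0 by rewrite coef_taylor_line mpolyC_eq0.
  by apply: contraR; rewrite -ltnNge => ?; rewrite nth_default // -ltnS prednK // lt0n msize_poly_eq0.
set c := (top_form q).@[v 0] in tv.
have lQ : lead_coef Q = c%:MP by rewrite /lead_coef sQ coef_taylor_line.
have svn0 : sv v != 0 by apply: contraNneq Sv => E; rewrite -svE E meval0.
have ED := Pdiv.Idomain.divp_eq P Q.
(* For x with S(x, v) nonzero, [Q] divides [P] after specialisation, so the specialised remainder,
   of smaller degree, is 0. Such x are dense. *)
have R0 : P %% Q = 0.
  apply/polyP => i; rewrite coef0; apply: (mulfI svn0); rewrite mulr0.
  apply: mpoly_fun_eq0 => x _; rewrite mevalM.
  have [->|sx] := eqVneq (sv v).@[x 0] 0; first by rewrite mul0r.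
  rewrite svE in sx; have lX := SX _ _ sx.
  pose ev := map_poly (meval (x 0)).
  have sevQ : size (ev Q) = size Q by rewrite size_map_poly_id0 // lQ mevalC.
  have evQ0 : ev Q != 0 by rewrite -size_poly_eq0 sevQ sQ msize_poly_eq0.
  have dvd : ev Q %| ev P.
    apply: dvdp_local => // t.
    have [o' [p' [q' [o'n0 q't _ H']]]] := loc _ (lX t).
    exists (ev (taylor_line v p')), (ev (taylor_line v q')); split.
      exact: taylor_line_eqM (glue _ _ _ o'n0 H').
    by rewrite /ev taylor_lineE.
  suff : ev (P %% Q) = 0 by move=> /(congr1 (coefp i)) /=; rewrite coef0 coef_map /= => ->; rewrite mulr0.
  have : ev Q %| ev (P %% Q).
    have := congr1 ev ED; rewrite /ev map_polyZ rmorphD rmorphM /= -/ev => E.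
    by rewrite -(dvdp_addr (ev (P %% Q)) (dvdp_mull (ev (P %/ Q)) (dvdpp (ev Q)))) -E dvdpZr ?rmorphXn ?lQ ?expf_neq0 //= mevalC.
  move=> dR; apply/eqP; apply: contraLR (dR) => nz; apply: contraTN (dvdp_leq nz dR) => _.
  rewrite -ltnNge sevQ (leq_ltn_trans (size_poly _ _)) // ltn_modp.
  by rewrite -size_poly_eq0 sQ msize_poly_eq0.
have P0 : P.[0] = p := taylor_line0 v p.
have Q0 : Q.[0] = q := taylor_line0 v q.
clearbody P Q; rewrite R0 addr0 lQ in ED.
have := congr1 (fun r => r.[0]) ED; rewrite hornerZ hornerM P0 Q0 => E.
set k := scalp P Q in E; set a := (P %/ Q).[0] in E.
have E' x : c ^+ k * p.@[x 0] = a.@[x 0] * q.@[x 0].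
  by rewrite -mevalM -E mevalM rmorphXn /= mevalC.
exists ((c ^- k) *: a) => x Xx.
have [o' [p' [q' [o'n0 q'x o'x H']]]] := loc _ Xx.
have [_ ->] := H' x Xx o'x.
(* Through [glue] the formula reaches every point of [X], also those where the law vanishes in
   direction v. *)
suff -> : p' = (c ^- k *: a) * q' by rewrite mevalM mulfK.
apply: (mulfI q0); rewrite (glue _ _ _ o'n0 H') mulrA; congr (_ * _).
apply/eqP; rewrite -subr_eq0; apply/eqP; apply: mpoly_fun_eq0 => y _.
rewrite mevalB mevalM mevalZ mulrCA [_.@[_] * a.@[_]]mulrC -E'.
by rewrite mulrA mulVf ?expf_neq0 // mul1r subrr.
Qed.
End Hartogs.

(** * Sylvester determinants and generic lines *)

Definition coef_mx (L : nzRingType) M (r : 'I_M -> {poly L}) : 'M[L]_M :=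
  \matrix_(i, j) (r i)`_j.

Lemma map_coef_mx (L L' : nzRingType) (f : {rmorphism L -> L'}) M (r : 'I_M -> {poly L}) :
  map_mx f (coef_mx r) = coef_mx (fun i => map_poly f (r i)).
Proof. by apply/matrixP => i j; rewrite !mxE coef_map. Qed.

Section CoefDet.
Variables (F : fieldType) (M : nat).
Implicit Types r : 'I_M -> {poly F}.

(** The column (1, z, z^2, ...) is a nonzero kernel vector. *)
Lemma det_coef_mx_root r z : (0 < M)%N ->
  (forall i, (size (r i) <= M)%N) -> (forall i, root (r i) z) -> \det (coef_mx r) = 0.
Proof.
move=> M0 sr rz; apply/eqP; apply: contraT => nz.
pose c : 'cV[F]_M := \col_j z ^+ j.
have rc : coef_mx r *m c = 0.
  apply/colP => i; rewrite !mxE -[RHS](rootP (rz i)) (horner_coef_wide _ (sr i)).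
  by apply: eq_bigr => j _; rewrite !mxE.
have U : coef_mx r \in unitmx by rewrite unitmxE unitfE.
have : c = 0 by rewrite -[c](mulKmx U) rc mulmx0.
move=> /colP/(_ (Ordinal M0)); rewrite !mxE expr0 => /eqP.
by rewrite oner_eq0.
Qed.

Lemma det_coef_mx_neq0 r : (forall i, (size (r i) <= M)%N) ->
  (forall u : 'rV_M, \sum_i u 0 i *: r i = 0 -> u = 0) -> \det (coef_mx r) != 0.
Proof.
move=> sr free; apply/negP => /det0P[u /eqP u0 ur]; apply: u0; apply: free.
apply/polyP => k; rewrite coef0 coef_sum.
have [kM|kM] := ltnP k M; last first.
  by rewrite big1 // => i _; rewrite coefZ nth_default ?mulr0 // (leq_trans (sr i)).
move/rowP/(_ (Ordinal kM)): ur; rewrite !mxE => ur; rewrite -[RHS]ur.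
by apply: eq_bigr => i _; rewrite coefZ mxE.
Qed.

End CoefDet.

Lemma sum_rVpoly (L : nzRingType) k (u : 'rV[L]_k) (a : {poly L}) :
  \sum_i u 0 i *: ('X^i * a) = rVpoly u * a.
Proof.
rewrite [u in RHS]row_sum_delta linear_sum mulr_suml; apply: eq_bigr => i _ /=.
by rewrite linearZ /= rVpoly_delta scalerAl.
Qed.

Definition sylvester_row (L : nzRingType) k m (a b : {poly L}) (i : 'I_(k + m)) : {poly L} :=
  match split i with inl j => 'X^j * a | inr j => 'X^j * b end.

Lemma map_sylvester_row (L L' : nzRingType) (f : {rmorphism L -> L'}) k m (a b : {poly L}) i :
  map_poly f (@sylvester_row L k m a b i) = sylvester_row (map_poly f a) (map_poly f b) i.
Proof. by rewrite /sylvester_row; case: split => j; rewrite rmorphM /= map_polyXn. Qed.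

Lemma sum_sylvester_row (L : nzRingType) k m (a b : {poly L}) (u : 'rV_(k + m)) :
  \sum_i u 0 i *: sylvester_row a b i = rVpoly (lsubmx u) * a + rVpoly (rsubmx u) * b.
Proof.
rewrite big_split_ord -!sum_rVpoly; congr (_ + _); apply: eq_bigr => i _.
  by rewrite !mxE /sylvester_row (unsplitK (inl _ i)).
by rewrite !mxE /sylvester_row (unsplitK (inr _ i)).
Qed.

(** Up to sign, the resultant of a and b for the formal degrees m and k. Working over any
    commutative ring is what makes it usable in a [natural_law]. *)
Definition sylvester_det (L : comNzRingType) k m (a b : {poly L}) : L :=
  \det (coef_mx (@sylvester_row L k m a b)).

Lemma map_sylvester_det (L L' : comNzRingType) (f : {rmorphism L -> L'}) k m (a b : {poly L}) :
  f (sylvester_det k m a b) = sylvester_det k m (map_poly f a) (map_poly f b).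
Proof.
rewrite /sylvester_det -det_map_mx map_coef_mx; congr (\det _).
by apply/matrixP => i j; rewrite !mxE map_sylvester_row.
Qed.

Section Sylvester.
Variables (F : fieldType) (k m : nat) (a b : {poly F}).
Hypotheses (sb : (size b <= k.+1)%N).

Lemma size_sylvester_row i : (size a <= m.+1)%N ->
  (size (@sylvester_row F k m a b i) <= k + m)%N.
Proof.
rewrite /sylvester_row => sa.
case: (split i) => j; rewrite (leq_trans (size_polyMleq _ _)) // size_polyXn /=.
  by rewrite (leq_trans (leq_add (leqnn j) sa)) // addnS -addSn leq_add2r.
by rewrite (leq_trans (leq_add (leqnn j) sb)) // addnS -addSn addnC leq_add2l.
Qed.

Lemma sylvester_det_root z : (0 < k)%N -> (size a <= m.+1)%N -> root a z -> root b z ->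
  sylvester_det k m a b = 0.
Proof.
move=> k0 sa az bz; apply: (det_coef_mx_root (z := z)) => [|i|i]; first by rewrite addn_gt0 k0.
  exact: size_sylvester_row.
by rewrite /sylvester_row; case: split => j; rewrite rootM ?az ?bz orbT.
Qed.

Lemma sylvester_det_neq0 : size a = m.+1 -> coprimep a b -> sylvester_det k m a b != 0.
Proof.
move=> sa cab; apply: det_coef_mx_neq0 => [i|u].
  by rewrite size_sylvester_row ?sa.
rewrite sum_sylvester_row => E.
have a0 : a != 0 by rewrite -size_poly_eq0 sa.
have r0 : rVpoly (rsubmx u) = 0.
  apply/eqP; apply: contraT => nz.
  have : a %| rVpoly (rsubmx u) * b.
    by rewrite -(dvdp_addr _ (dvdp_mull (rVpoly (lsubmx u)) (dvdpp a))) E dvdp0.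
  rewrite Gauss_dvdpl // => /(dvdp_leq nz); rewrite sa ltnNge size_poly //.
move: E; rewrite r0 mul0r addr0 => /eqP; rewrite mulf_eq0 (negPf a0) orbF => /eqP l0.
rewrite -[u]hsubmxK -[lsubmx u]rVpolyK -[rsubmx u]rVpolyK l0 r0.
by apply/rowP => i; rewrite !mxE; case: split => j; rewrite mxE coef0.
Qed.

End Sylvester.

(** The same body as [monic_of], but over any ring, since laws are also evaluated over polynomial
    rings. *)
Definition monic_poly_of (L : nzRingType) m (v : 'rV[L]_m) : {poly L} := 'X^m + rVpoly v.

Lemma map_monic_poly_of (L L' : nzRingType) (f : {rmorphism L -> L'}) m (v : 'rV[L]_m) :
  map_poly f (monic_poly_of v) = monic_poly_of (map_mx f v).
Proof. by rewrite rmorphD /= map_polyXn map_rVpoly. Qed.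

Lemma size_monic_poly_of (L : nzRingType) m (v : 'rV[L]_m) : size (monic_poly_of v) = m.+1.
Proof. by rewrite size_polyDl size_polyXn // ltnS size_poly. Qed.

Lemma monic_poly_ofP (L : nzRingType) m (v : 'rV[L]_m) : monic_poly_of v \is monic.
Proof. by rewrite monicE lead_coefDl ?lead_coefXn // size_polyXn ltnS size_poly. Qed.

Lemma monic_poly_ofD (L : nzRingType) m (u v : 'rV[L]_m) t :
  monic_poly_of (u + t *: v) = monic_poly_of u + t *: rVpoly v.
Proof. by rewrite /monic_poly_of linearD linearZ addrA. Qed.

Lemma monic_poly_of_poly_rV (L : nzRingType) m (p : {poly L}) :
  p \is monic -> size p = m.+1 -> monic_poly_of (poly_rV p : 'rV_m) = p.
Proof.
move=> /monicP lp sp; apply/polyP => i; rewrite coefD coefXn coef_rVpoly.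
case: insubP => [j _ <-|]; first by rewrite mxE (ltn_eqF (ltn_ord j)) add0r.
rewrite -leqNgt addr0 leq_eqVlt => /orP[/eqP <-|mi].
  by rewrite eqxx -lp /lead_coef sp.
by rewrite (gtn_eqF mi) nth_default // sp.
Qed.

Lemma size_deriv_leq (L : nzRingType) (p : {poly L}) a :
  (size p <= a.+1)%N -> (size p^`() <= a)%N.
Proof.
move=> pa; have [->|p0] := eqVneq p 0; first by rewrite deriv0 size_poly0.
by rewrite -ltnS (leq_trans (lt_size_deriv p0)).
Qed.

Lemma size_polyM_le (L : nzRingType) (p q : {poly L}) a b :
  (size p <= a)%N -> (size q <= b)%N -> (size (p * q)%R <= (a + b).-1)%N.
Proof.
by move=> pa qb; rewrite (leq_trans (size_polyMleq _ _)) // -!subn1 leq_sub2r // leq_add.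
Qed.

(** * Lines avoiding the polynomials with a root of multiplicity three *)

Section PolyVar.

(** Replacing P by P + t V leaves the Wronskian P V' - P' V unchanged, so a single polynomial
    controls the whole line. *)
Definition poly_wronskian (L : comNzRingType) m (x v : 'rV[L]_m) : {poly L} :=
  monic_poly_of x * (rVpoly v)^`() - (monic_poly_of x)^`() * rVpoly v.

(** A root of P + t V of multiplicity at least three is at least a double root of the Wronskian,
    which the resultant with the derivative detects. *)
Definition poly_law m : line_law m := fun L x v =>
  sylvester_det m.*2 m.*2.-2 (poly_wronskian x v) (poly_wronskian x v)^`().

Lemma natural_poly_law m : natural_law (@poly_law m).
Proof.
move=> L L' f x v; rewrite /poly_law map_sylvester_det -deriv_map.
by rewrite rmorphB !rmorphM /= -!deriv_map map_monic_poly_of map_rVpoly.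
Qed.

Lemma size_poly_wronskian (L : comNzRingType) m (x v : 'rV[L]_m) : (1 < m)%N ->
  (size (poly_wronskian x v) <= m.*2.-2.+1)%N.
Proof.
case: m x v => [|[|m]] // x v _.
rewrite (leq_trans (size_polyD _ _)) // geq_max size_polyN; apply/andP; split.
  apply: leq_trans (size_polyM_le (a := m.+3) (b := m.+1) _ _) _; rewrite ?size_monic_poly_of //.
    exact/size_deriv_leq/size_poly.
  by lia.
apply: leq_trans (size_polyM_le (a := m.+2) (b := m.+2) _ _) _.
- by apply: size_deriv_leq; rewrite size_monic_poly_of.
- exact: size_poly.
by lia.
Qed.

Variables (K : numClosedFieldType) (m k : nat).
Hypotheses (m2 : (1 < m)%N).

Lemma poly_law_neq0 (x v : 'rV[K]_m) : (2 < k)%N -> poly_law x v != 0 ->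
  forall t, Poly_var K m k (x + t *: v).
Proof.
move=> k3 + t [z]; apply: contraNnot; rewrite -[monic_of _]/(monic_poly_of _) => kz.
have := leq_trans k3 kz; rewrite mup_geq -?size_poly_eq0 ?size_monic_poly_of // => dv.
set P := monic_poly_of x; set V := rVpoly v.
have EW : P * V^`() - P^`() * V = (P + t *: V) * V^`() - (P + t *: V)^`() * V.
  by rewrite derivD derivZ -!mul_polyC; ring.
have [g Eg] := dvdpP _ _ dv; rewrite monic_poly_ofD -/P -/V in Eg.
rewrite -/(poly_wronskian x v) in EW.
have [h Eh] : exists h, poly_wronskian x v = ('X - z%:P) ^+ 2 * h.
  exists (('X - z%:P) * g * V^`() - (3%:R * g + ('X - z%:P) * g^`()) * V).
  rewrite EW Eg derivM deriv_exp derivXsubC /= -mulr_natl; ring.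
have sW := size_poly_wronskian x v m2.
rewrite /poly_law; apply/eqP; apply: (@sylvester_det_root _ _ _ _ _ _ z) => //.
- by apply: size_deriv_leq; rewrite (leq_trans sW) //; lia.
- by rewrite double_gt0 (ltn_trans _ m2).
- by rewrite Eh rootM root_exp_XsubC eqxx.
- have -> : (poly_wronskian x v)^`() = ('X - z%:P) * (2%:R * h + ('X - z%:P) * h^`()).
    by rewrite Eh derivM deriv_exp derivXsubC /= -mulr_natl; ring.
  by rewrite rootM root_XsubC eqxx.
Qed.

Lemma poly_law_witness : exists x v : 'rV[K]_m, poly_law x v != 0.
Proof.
case: m m2 => [|[|j]] // _.
(* With y = X^(j+1) the Wronskian becomes -(y^2 + c y + 2). Its discriminant c^2 - 8 and its
   constant term are nonzero, so it has no double root in X. *)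
exists (poly_rV ('X^(j.+2) + 'X)), (poly_rV ('X^(j.+1) + 2%:P)).
set c : K := j.+4%:R.
have EP : monic_poly_of (poly_rV ('X^(j.+2) + 'X : {poly K}) : 'rV_j.+2) = 'X^(j.+2) + 'X.
  by rewrite monic_poly_of_poly_rV // ?monicE ?lead_coefDl ?size_polyDl
    ?lead_coefXn ?size_polyXn ?size_polyX.
have EV : rVpoly (poly_rV ('X^(j.+1) + 2%:P : {poly K}) : 'rV_j.+2) = 'X^(j.+1) + 2%:P.
  by rewrite poly_rV_K // size_polyDl size_polyXn // ltnS (leq_trans (size_polyC_leq1 _)).
have EW : poly_wronskian (poly_rV ('X^(j.+2) + 'X : {poly K}) : 'rV_j.+2) (poly_rV ('X^(j.+1) + 2%:P)) =
    - ('X^(j.+1) * 'X^(j.+1) + c%:P * 'X^(j.+1) + 2%:P).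
  rewrite /poly_wronskian EP EV !derivD !derivXn derivX derivC addr0 /=.
  rewrite -['X^_ *+ j.+2]mulr_natl -['X^_ *+ j.+1]mulr_natl.
  have -> : c%:P = (j.+1)%:R + 3%:R by rewrite -natrD polyC_natr addn3.
  have -> : (j.+2)%:R = (j.+1)%:R + 1 :> {poly K} by rewrite natr1.
  by rewrite polyC_natr !exprS; move: ('X^j) (j.+1%:R) => y a; ring.
have sW : size (poly_wronskian (poly_rV ('X^(j.+2) + 'X : {poly K}) : 'rV_j.+2)
    (poly_rV ('X^(j.+1) + 2%:P))) = (j.+2).*2.-2.+1.
  rewrite EW size_polyN -addrA -exprD size_polyDl size_polyXn; first by lia.
  rewrite (leq_ltn_trans (size_polyD _ _)) // gtn_max.
  rewrite (leq_ltn_trans (size_polyC_leq1 _)) ?addnS // andbT mul_polyC.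
  by rewrite (leq_ltn_trans (size_scale_leq _ _)) // size_polyXn !ltnS leq_addr.
apply: sylvester_det_neq0 => //.
  by apply: size_deriv_leq; rewrite sW; lia.
have EW' : (- ('X^(j.+1) * 'X^(j.+1) + c%:P * 'X^(j.+1) + 2%:P))^`() =
    - ((2%:P * 'X^(j.+1) + c%:P) * ('X^j *+ j.+1)) :> {poly K}.
  rewrite derivN !derivD !derivM !derivC derivXn /= polyC_natr; ring.
apply/Pdiv.ClosedField.coprimepP => x; rewrite EW EW' !rootE.
rewrite !(hornerN, hornerD, hornerM, hornerC, hornerXn, hornerMn) !oppr_eq0.
set y := x ^+ j.+1 => /eqP ry; rewrite mulf_eq0 negb_or; apply/andP; split.
  apply/eqP => ey.
  have : c * c = 8.
    apply/eqP; rewrite -subr_eq0; apply/eqP.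
    have -> : c * c - 8 = (2 * y + c) * (2 * y + c) - 4 * (y * y + c * y + 2) by ring.
    by rewrite ry ey !mulr0 subr0.
  by rewrite /c -natrM => /eqP; rewrite eqr_nat => /eqP; lia.
rewrite mulrn_eq0 /= expf_eq0 negb_and; apply/orP; right; apply/eqP => x0.
move: ry; rewrite /y x0 expr0n /= !mulr0 !add0r => /eqP.
by rewrite pnatr_eq0.
Qed.

End PolyVar.

(** * Lines avoiding the tuples with a common root *)

Section RatVar.
Variables d n : nat.

Definition rat_comp (L : nzRingType) (u : 'rV[L]_(n.+1 * d)) (i : 'I_n.+1) : {poly L} :=
  monic_poly_of (row i (vec_mx u)).

Definition rat_dir (L : nzRingType) (v : 'rV[L]_(n.+1 * d)) (i : 'I_n.+1) : {poly L} :=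
  rVpoly (row i (vec_mx v)).

Lemma map_rat_comp (L L' : nzRingType) (f : {rmorphism L -> L'}) u i :
  map_poly f (@rat_comp L u i) = rat_comp (map_mx f u) i.
Proof. by rewrite /rat_comp map_monic_poly_of map_row map_vec_mx. Qed.

Lemma map_rat_dir (L L' : nzRingType) (f : {rmorphism L -> L'}) u i :
  map_poly f (@rat_dir L u i) = rat_dir (map_mx f u) i.
Proof. by rewrite /rat_dir map_rVpoly map_row map_vec_mx. Qed.

Lemma size_rat_comp (L : nzRingType) (u : 'rV[L]_(n.+1 * d)) i : size (rat_comp u i) = d.+1.
Proof. exact: size_monic_poly_of. Qed.

Lemma size_rat_dir (L : nzRingType) (u : 'rV[L]_(n.+1 * d)) i : (size (rat_dir u i) <= d)%N.
Proof. exact: size_poly. Qed.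

Lemma rat_compD (L : nzRingType) (u v : 'rV[L]_(n.+1 * d)) t i :
  rat_comp (u + t *: v) i = rat_comp u i + t *: rat_dir v i.
Proof. by rewrite /rat_comp !linearD !linearZ /= monic_poly_ofD. Qed.

Definition rat_vec (L : nzRingType) (G : 'I_n.+1 -> {poly L}) : 'rV[L]_(n.+1 * d) :=
  mxvec (\matrix_i poly_rV (G i)).

Lemma rat_comp_vec (L : nzRingType) (G : 'I_n.+1 -> {poly L}) i :
  G i \is monic -> size (G i) = d.+1 -> rat_comp (rat_vec G) i = G i.
Proof. by move=> Gm Gs; rewrite /rat_comp mxvecK rowK monic_poly_of_poly_rV. Qed.

Lemma rat_dir_vec (L : nzRingType) (G : 'I_n.+1 -> {poly L}) i :
  (size (G i) <= d)%N -> rat_dir (rat_vec G) i = G i.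
Proof. by move=> Gs; rewrite /rat_dir mxvecK rowK poly_rV_K. Qed.

(** If all f_i + t v_i vanish at z, the vectors (f_i(z)) and (v_i(z)) are proportional, so every
    minor vanishes at z, whatever t is. Two minors without common root therefore keep the whole line
    away from R; having two of them takes three components, hence n >= 2. *)
Definition rat_minor (L : comNzRingType) (u v : 'rV[L]_(n.+1 * d)) i j : {poly L} :=
  rat_comp u i * rat_dir v j - rat_comp u j * rat_dir v i.

Definition rat_law : line_law (n.+1 * d) := fun L u v =>
  sylvester_det d.*2.-1 d.*2.-1 (rat_minor u v ord0 (inord 1)) (rat_minor u v (inord 1) (inord 2)).

Lemma natural_rat_law : natural_law rat_law.
Proof.
move=> L L' f u v; rewrite /rat_law map_sylvester_det.
by rewrite /rat_minor !rmorphB !rmorphM /= !map_rat_comp !map_rat_dir.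
Qed.

Lemma size_rat_minor (L : comNzRingType) (u v : 'rV[L]_(n.+1 * d)) i j :
  (size (rat_minor u v i j) <= d.*2)%N.
Proof.
have sM k l : (size (rat_comp u k * rat_dir v l)%R <= d.*2)%N.
  rewrite (leq_trans (size_polyMleq _ _)) // size_rat_comp addSn /= -addnn.
  by rewrite leq_add2l size_rat_dir.
by rewrite (leq_trans (size_polyD _ _)) // geq_max size_polyN !sM.
Qed.

Variable K : numClosedFieldType.
Hypothesis d1 : (0 < d)%N.

Lemma rat_law_neq0 (x v : 'rV[K]_(n.+1 * d)) : rat_law x v != 0 ->
  forall t, Rat_var K d n (x + t *: v).
Proof.
move=> + t [z fz]; have {}fz i : (rat_comp x i).[z] = - t * (rat_dir v i).[z].
  have := rootP (fz i); rewrite -[monic_of _]/(rat_comp (x + t *: v) i) rat_compD.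
  by rewrite hornerD hornerZ => /eqP; rewrite addr_eq0 mulNr => /eqP.
have mz i j : root (rat_minor x v i j) z.
  by rewrite rootE hornerD hornerN !hornerM !fz; apply/eqP; ring.
move/negP; apply; apply/eqP; have d2 : (0 < d.*2)%N by rewrite double_gt0.
apply: (@sylvester_det_root _ _ _ _ _ _ z) => //; rewrite ?prednK ?size_rat_minor //.
by lia.
Qed.

Lemma rat_law_witness : (1 < d)%N -> (1 < n)%N ->
  exists x v : 'rV[K]_(n.+1 * d), rat_law x v != 0.
Proof.
move=> d2 n2.
(* Chosen so that the minor of 1 and 2 is the constant 1 and that of 0 and 1 has the full degree 2d
   - 1. *)
pose G (i : 'I_n.+1) : {poly K} := if i == inord 1 then 'X^d + 1 else 'X^d.
pose V (i : 'I_n.+1) : {poly K} := if i == ord0 then - 'X^(d.-1) else 1.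
exists (rat_vec G), (rat_vec V).
have G2 i : rat_comp (rat_vec G) i = G i.
  rewrite rat_comp_vec // /G; case: eqP => _; rewrite ?monicXn ?size_polyXn //.
    by rewrite monicE lead_coefDl ?lead_coefXn // size_polyXn size_poly1 ltnS.
  by rewrite size_polyDl size_polyXn // size_poly1 ltnS.
have V2 i : rat_dir (rat_vec V) i = V i.
  rewrite rat_dir_vec // /V; case: eqP => _; rewrite ?size_poly1 //.
  by rewrite size_polyN size_polyXn prednK.
have n10 : (inord 1 == ord0 :> 'I_n.+1) = false by rewrite -val_eqE /= inordK // ltnS ltnW.
have n21 : (inord 2 == inord 1 :> 'I_n.+1) = false.
  by rewrite -val_eqE /= !inordK // ltnS ltnW.
have n20 : (inord 2 == ord0 :> 'I_n.+1) = false by rewrite -val_eqE /= inordK.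
have Eb : rat_minor (rat_vec G) (rat_vec V) (inord 1) (inord 2) = 1.
  by rewrite /rat_minor !G2 !V2 /G /V eqxx n10 n21 n20; ring.
have Ea : rat_minor (rat_vec G) (rat_vec V) ord0 (inord 1) = 'X^(d.*2.-1) + ('X^d + 'X^(d.-1)).
  have n01 : (ord0 == inord 1 :> 'I_n.+1) = false by rewrite eq_sym.
  rewrite /rat_minor !G2 !V2 /G /V !eqxx n10 n01.
  have -> : d.*2.-1 = (d + d.-1)%N by lia.
  rewrite exprD; ring.
rewrite /rat_law Ea Eb; apply: sylvester_det_neq0; rewrite ?size_poly1 ?coprimep1 //.
rewrite size_polyDl size_polyXn // (leq_ltn_trans (size_polyD _ _)) // gtn_max !size_polyXn.
by lia.
Qed.

End RatVar.

(** * Polynomial maps between complements *)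

Section PolyMap.
Variable K : numClosedFieldType.

Definition poly_map N M (Phi : M.-tuple {mpoly K[N]}) (x : 'rV[K]_N) : 'rV[K]_M :=
  \row_j (tnth Phi j).@[x 0].

Definition diff_map N M (Phi : M.-tuple {mpoly K[N]}) (x v : 'rV[K]_N) : 'rV[K]_M :=
  \row_j grad (tnth Phi j) x v.

Lemma meval_comp N M (Phi : M.-tuple {mpoly K[N]}) G (x : 'rV[K]_N) :
  (G \mPo Phi).@[x 0] = G.@[poly_map Phi x 0].
Proof. by rewrite comp_mpoly_meval; apply: meval_eq => j; rewrite mxE. Qed.

Lemma coef1_mmap N (G : {mpoly K[N]}) (x v : 'rV[K]_N) (e : 'I_N -> {poly K}) :
  (forall i, (e i)`_0 = v 0 i) ->
  (mmap polyC (fun i => (x 0 i)%:P + 'X * e i) G)`_1 = grad G x v.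
Proof.
move=> ev; have [h] := taylor1 G x e 1; rewrite expr1 => ->.
rewrite -mulrA !coefD coefC !coefXM /= add0r addr0 coef_sum.
by apply: eq_bigr => i _; rewrite coefMC ev.
Qed.

Lemma grad_comp N M (Phi : M.-tuple {mpoly K[N]}) (G : {mpoly K[M]}) x v :
  grad (G \mPo Phi) x v = grad G (poly_map Phi x) (diff_map Phi x v).
Proof.
pose c i : {poly K} := (x 0 i)%:P + 'X * (v 0 i)%:P.
have H j : exists h, mmap polyC c (tnth Phi j) =
    (poly_map Phi x 0 j)%:P + 'X * ((grad (tnth Phi j) x v)%:P + 'X * h).
  have [h] := taylor1 (tnth Phi j) x (fun i => (v 0 i)%:P) 1.
  rewrite expr1 => E; exists h; rewrite mxE mulrDr addrA mulrA /c E; congr (_ + _ * _ + _).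
  by rewrite /grad rmorph_sum; apply: eq_bigr => i _; rewrite /= polyCM.
have [h hE] := choice H.
rewrite -(@coef1_mmap _ _ _ _ (fun i => (v 0 i)%:P)); last by move=> i; rewrite coefC.
rewrite -(@coef1_mmap _ _ _ _ (fun j => (grad (tnth Phi j) x v)%:P + 'X * h j)); last first.
  by move=> j; rewrite coefD coefC coefXM mxE addr0.
rewrite /comp_mpoly rmorph_mmap; apply: (congr1 (fun p : {poly K} => p`_1)); apply: eq_mmap => [a|j] /=.
  by rewrite mmapC.
exact: hE.
Qed.

Lemma diff_mapE N M (Phi : M.-tuple {mpoly K[N]}) x v :
  diff_map Phi x v = v *m \matrix_(i, j) ((tnth Phi j)^`M(i)).@[x 0].
Proof. by apply/rowP => j; rewrite !mxE; apply: eq_bigr => i _; rewrite mxE. Qed.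

Lemma grad_X N i (x v : 'rV[K]_N) : grad 'X_i x v = v 0 i.
Proof.
rewrite -(@coef1_mmap _ _ _ _ (fun i => (v 0 i)%:P)); last by move=> j; rewrite coefC.
by rewrite mmapX mmap1U coefD coefC coefXM coefC add0r.
Qed.

(* Holds when the complement of [X] has codimension at least two. *)
Definition generic_lines_in N (X : set 'rV[K]_N) : Prop :=
  exists S : line_law N, [/\ natural_law S, exists x v, S K x v != 0 &
    forall x v, S K x v != 0 -> forall t, X (x + t *: v)].

Lemma generic_lines_dense N (X : set 'rV[K]_N) G :
  generic_lines_in X -> vanishes_on X G -> G = 0.
Proof.
move=> [S [Snat [x0 [v0 S0]] SX]] GX.
pose s := S {mpoly K[N]} (\row_i 'X_i) (map_mx (@mpolyC N K) v0).
have sE (x : 'rV[K]_N) : s.@[x 0] = S K x v0.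
  rewrite [LHS](Snat _ _ (meval (x 0))) -map_mx_comp; congr S.
    by apply/rowP => i; rewrite !mxE /= mevalXU.
  by apply/rowP => i; rewrite !mxE /= mevalC.
have s0 : s != 0 by apply: contraNneq S0 => E; rewrite -sE E meval0.
apply: (mulfI s0); rewrite mulr0; apply: mpoly_fun_eq0 => x _; rewrite mevalM.
have [->|sx] := eqVneq s.@[x 0] 0; first by rewrite mul0r.
rewrite GX ?mulr0 //; rewrite sE in sx.
by have := SX _ _ sx 0; rewrite scale0r addr0.
Qed.

Lemma morphism_poly_map N M (X : set 'rV[K]_N) (Y : set 'rV[K]_M) phi :
  generic_lines_in X -> morphism X Y phi ->
  exists Phi : M.-tuple {mpoly K[N]}, forall x, X x -> phi x = poly_map Phi x.
Proof.
move=> [S [Snat [x0 [v0 S0]] SX]] [XY _ reg].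
have H j : exists p : {mpoly K[N]}, forall x, X x -> phi x 0 j = p.@[x 0].
  apply: (hartogs Snat S0 SX).
  have oT : zariski_open (setT : set 'rV[K]_M).
    exists (fun p => p = 1); apply/seteqP; split => [y []//|y /(_ 1 erefl)].
    by rewrite meval1 => /eqP; rewrite oner_eq0.
  have oY : open_in Y Y by exists setT; rewrite // setIT.
  have regY : regular_on Y (fun y => y 0 j).
    move=> y _; exists setT; split => //; exists 'X_j, 1 => z _.
    by rewrite meval1 mevalXU divr1 oner_eq0.
  have := reg Y _ oY regY; congr regular_on.
  by apply/seteqP; split => [x []|x Xx] //; split => //; apply: XY.
have [p pE] := choice H.
exists (mktuple p) => x Xx; apply/rowP => j.
by rewrite mxE tnth_mktuple pE.
Qed.

(** The sets are dense, so the extensions are mutually inverse everywhere; a point outside [X] sent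
    into [Y] would then come back into [X]. *)
Lemma isomorphic_poly_map N M (X : set 'rV[K]_N) (Y : set 'rV[K]_M) :
  generic_lines_in X -> generic_lines_in Y -> isomorphic X Y ->
  exists (Phi : M.-tuple {mpoly K[N]}) (Psi : N.-tuple {mpoly K[M]}),
    [/\ forall j, tnth Psi j \mPo Phi = 'X_j, forall j, tnth Phi j \mPo Psi = 'X_j,
        forall x, ~ X x -> ~ Y (poly_map Phi x) & forall y, ~ Y y -> ~ X (poly_map Psi y)].
Proof.
move=> gX gY [phi [psi [mphi mpsi psiK phiK]]].
have [Phi PhiE] := morphism_poly_map gX mphi.
have [Psi PsiE] := morphism_poly_map gY mpsi.
have [XY _ _] := mphi; have [YX _ _] := mpsi.
have EX j : tnth Psi j \mPo Phi = 'X_j.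
  apply/eqP; rewrite -subr_eq0; apply/eqP; apply: (generic_lines_dense gX) => x Xx.
  rewrite mevalB meval_comp mevalXU -PhiE //.
  have := psiK x Xx; rewrite (PsiE _ (XY _ Xx)) => /rowP/(_ j); rewrite mxE => ->.
  by rewrite subrr.
have EY j : tnth Phi j \mPo Psi = 'X_j.
  apply/eqP; rewrite -subr_eq0; apply/eqP; apply: (generic_lines_dense gY) => x Xx.
  rewrite mevalB meval_comp mevalXU -PsiE //.
  have := phiK x Xx; rewrite (PhiE _ (YX _ Xx)) => /rowP/(_ j); rewrite mxE => ->.
  by rewrite subrr.
have KX x : poly_map Psi (poly_map Phi x) = x.
  by apply/rowP => j; rewrite mxE -meval_comp EX mevalXU.
have KY y : poly_map Phi (poly_map Psi y) = y.
  by apply/rowP => j; rewrite mxE -meval_comp EY mevalXU.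
exists Phi, Psi; split=> // [x nXx YPx|y nYy XPy].
  by apply: nXx; rewrite -[x]KX -PsiE //; apply: YX.
by apply: nYy; rewrite -[y]KY -PhiE //; apply: XY.
Qed.

End PolyMap.

(** * The tangent space at a cusp of the multiple-root variety *)

Section Cusp.
Variable K : numClosedFieldType.

Lemma coef_expCsubX (L : comNzRingType) (a : L) N j :
  ((a%:P - 'X) ^+ N)`_j = (-1) ^+ j * a ^+ (N - j) * ('C(N, j))%:R.
Proof.
elim: N j => [|N IH] [|j].
- by rewrite bin0 subn0 !expr0 coef1 !mulr1.
- by rewrite expr0 coef1 bin0n mulr0.
- by rewrite exprS mulrBl coefB coefCM coefXM /= subr0 IH !bin0 !subn0 !mulr1 mulrCA -exprS.
rewrite exprS mulrBl coefB coefCM coefXM /= !IH binS subSS natrD.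
have [jN|jN] := ltnP j N.
  have -> : (N - j = (N - j.+1).+1)%N by lia.
  by rewrite !exprS; ring.
by rewrite bin_small ?ltnS // !exprS; ring.
Qed.

Variables M n : nat.
Hypotheses (n2 : (1 < n)%N) (nM : (n.+2 < M)%N).

(** The roots n + 2, ..., M - 1 are distinct, nonzero, and equal to their own index in
    [cusp_path_root]. *)
Definition cusp_unit : {poly K} := \prod_(n.+2 <= j < M) ('X - j%:R%:P).

Definition cusp_poly := 'X^(n.+2) * cusp_unit.

Definition cusp : 'rV[K]_M := poly_rV cusp_poly.

Lemma size_cusp_unit : size cusp_unit = (M - n.+1)%N.
Proof.
by rewrite /cusp_unit size_prod_XsubC size_iota; lia.
Qed.

Lemma monic_cusp_unit : cusp_unit \is monic.
Proof. exact: monic_prod_XsubC. Qed.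

Lemma coef0_cusp_unit : cusp_unit`_0 != 0.
Proof.
rewrite -horner_coef0 horner_prod prodf_seq_neq0; apply/allP => j.
by rewrite mem_index_iota => /andP[nj _] /=; rewrite !hornerE oppr_eq0 pnatr_eq0 -lt0n (leq_trans _ nj).
Qed.

Lemma monic_poly_of_cusp : monic_poly_of cusp = cusp_poly.
Proof.
apply: monic_poly_of_poly_rV; first by rewrite monicMl ?monicXn ?monic_cusp_unit.
rewrite size_Mmonic ?monic_cusp_unit -?size_poly_eq0 ?size_polyXn // size_cusp_unit; lia.
Qed.

Lemma cusp_in (u : {poly K}) (v : 'rV[K]_M) z : monic_poly_of v = ('X - z%:P) ^+ n.+1 * u ->
  (~` Poly_var K M n.+1)%classic v.
Proof.
move=> E; apply; exists z; rewrite mup_geq -[monic_of _]/(monic_poly_of v).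
  by rewrite E dvdp_mulr.
by rewrite -size_poly_eq0 size_monic_poly_of.
Qed.

Variable G : {mpoly K[M]}.
Hypothesis GD : vanishes_on (~` Poly_var K M n.+1)%classic G.

Lemma grad_cusp_mul (w : {poly K}) : (size w <= M - n.+1)%N ->
  grad G cusp (poly_rV ('X^(n.+1) * w)) = 0.
Proof.
move=> sw; apply: (grad_line_eq0 GD) => t.
apply: (@cusp_in ('X * cusp_unit + t *: w) _ 0).
rewrite subr0 monic_poly_ofD monic_poly_of_cusp poly_rV_K.
  by rewrite mulrDr -scalerAr mulrA -exprSr.
apply: (leq_trans (size_polyM_le (a := n.+2) _ sw)); rewrite ?size_polyXn //; lia.
Qed.

(* The curve [(X - t)^(n+1) (X + (n+1) t) h]: its order [2] and [3] terms in [t]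
   are multiples of [X^n h] and [X^(n-1) h]. *)
Definition cusp_curve : {poly {poly K}} :=
  (('X)%:P - 'X) ^+ n.+1 * (('X)%:P + (n.+1%:R)%:P * 'X) * cusp_unit%:P.

Lemma cusp_curveE : cusp_curve =
  ((('X)%:P - 'X) ^+ n.+1 * ('X)%:P + (('X)%:P - 'X) ^+ n.+1 * (n.+1%:R)%:P * 'X) * cusp_unit%:P.
Proof. by rewrite /cusp_curve; ring. Qed.

Lemma coef_cusp_curve j : cusp_curve`_j.+1 =
  ('X * ((-1) ^+ j.+1 * 'X ^+ (n.+1 - j.+1) * ('C(n.+1, j.+1))%:R)
    + n.+1%:R * ((-1) ^+ j * 'X ^+ (n.+1 - j) * ('C(n.+1, j))%:R)) * cusp_unit.
Proof.
rewrite cusp_curveE coefMC coefD !coefMC coefMX !coefMC !coef_expCsubX.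
by congr (_ * _); rewrite mulrC [_ * n.+1%:R]mulrC.
Qed.

(** The factor n + 1 in X + (n + 1) t cancels the term of order one in t. This gives the form
    required by [vanishes_curve] with k = 2, so that orders 2 and 3 both yield tangent vectors. *)
Lemma cusp_curve_drop : cusp_curve = cusp_poly%:P + 'X^2 * drop_poly 2 cusp_curve.
Proof.
rewrite -[LHS](poly_take_drop 2) mulrC; congr (_ + _); apply/polyP => -[|[|j]].
- rewrite coef_take_poly coefC /= cusp_curveE coefMC coefD coefMC coefMX addr0.
  by rewrite coef_expCsubX /= subn0 bin0 mulr1 mul1r -exprSr.
- rewrite coef_take_poly coefC coef_cusp_curve /= bin1 bin0 expr0 expr1 !mul1r subn0 subSS subn0.
  by rewrite exprS; ring.
by rewrite coef_take_poly coefC.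
Qed.

Lemma horner_cusp_curve t : cusp_curve.[t%:P] =
  ('X - t%:P) ^+ n.+1 * (('X + (n.+1%:R * t)%:P) * cusp_unit).
Proof.
rewrite /cusp_curve !(hornerM, hornerD, horner_exp, hornerN, hornerX, hornerC).
by rewrite polyCM polyC_natr -mulrA.
Qed.

Lemma size_horner_cusp_curve t : size cusp_curve.[t%:P] = M.+1.
Proof.
have mX : 'X + (n.+1%:R * t)%:P \is monic.
  by rewrite monicE lead_coefDl ?lead_coefX // size_polyX ltnS size_polyC_leq1.
rewrite horner_cusp_curve !size_Mmonic ?monicMl ?monic_cusp_unit //.
- rewrite size_exp_XsubC size_cusp_unit size_polyDl ?size_polyX; first by lia.
  by rewrite ltnS size_polyC_leq1.
- exact: monic_neq0.
- by rewrite monic_neq0 // monic_exp // monicXsubC.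
Qed.

Lemma monic_horner_cusp_curve t : cusp_curve.[t%:P] \is monic.
Proof.
have mX : 'X + (n.+1%:R * t)%:P \is monic.
  by rewrite monicE lead_coefDl ?lead_coefX // size_polyX ltnS size_polyC_leq1.
by rewrite horner_cusp_curve !monicMl // ?monic_exp ?monicXsubC ?monic_cusp_unit.
Qed.

Lemma grad_cusp_curve j : (j < 2)%N ->
  grad G cusp (poly_rV (cusp_curve`_(j.+2))) = 0.
Proof.
move=> j2; have -> : cusp_curve`_(j.+2) = (drop_poly 2 cusp_curve)`_j by rewrite coef_drop_poly addn2.
apply: (vanishes_curve GD _ j2) => t.
apply: (@cusp_in (('X + (n.+1%:R * t)%:P) * cusp_unit) _ t); rewrite -horner_cusp_curve.
have [->|t0] := eqVneq t 0.
  rewrite expr0n scale0r addr0 monic_poly_of_cusp [in RHS]cusp_curve_drop.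
  by rewrite hornerD hornerC hornerM hornerXn polyC0 expr0n mul0r addr0.
have EB : t ^+ 2 *: (drop_poly 2 cusp_curve).[t%:P] = cusp_curve.[t%:P] - cusp_poly.
  by rewrite [in RHS]cusp_curve_drop hornerD hornerC hornerM hornerXn -polyC_exp mul_polyC
    addrAC subrr add0r.
have -> : cusp + t ^+ 2 *: poly_rV (drop_poly 2 cusp_curve).[t%:P] =
    poly_rV cusp_curve.[t%:P] :> 'rV_M.
  by rewrite -linearZ /= EB linearB /= addrC subrK.
by rewrite monic_poly_of_poly_rV ?monic_horner_cusp_curve ?size_horner_cusp_curve.
Qed.

Let cusp_form (p : {poly K}) := grad G cusp (poly_rV p).

Let cusp_form_linear a p q : cusp_form (a *: p + q) = a * cusp_form p + cusp_form q.
Proof. by rewrite /cusp_form linearP grad_is_linear. Qed.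

Let cusp_formZ a p : cusp_form (a *: p) = a * cusp_form p.
Proof.
rewrite -[a *: p]addr0 cusp_form_linear [X in _ + X](_ : _ = 0) ?addr0 //.
by rewrite /cusp_form linear0 /grad big1 // => i _; rewrite mxE mul0r.
Qed.

Lemma grad_cusp_Xn : cusp_form ('X^n * cusp_unit) = 0.
Proof.
have := grad_cusp_curve (isT : (0 < 2)%N); rewrite coef_cusp_curve bin1.
have -> : (n.+1 - 2 = n.-1)%N by lia.
have -> : (n.+1 - 1 = n)%N by lia.
set c := 'C(n.+1, 2).
have -> : ('X * ((-1) ^+ 2 * 'X^(n.-1) * c%:R)
    + n.+1%:R * ((-1) ^+ 1 * 'X^n * n.+1%:R)) * cusp_unit =
    (c%:R - (n.+1 * n.+1)%:R) *: ('X^n * cusp_unit) :> {poly K}.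
  have -> : 'X^n = 'X * 'X^(n.-1) :> {poly K} by rewrite -exprS prednK // ltnW.
  by rewrite -mul_polyC polyCB !polyC_natr natrM; ring.
rewrite -/(cusp_form _) cusp_formZ => /eqP; rewrite mulf_eq0 => /orP[|/eqP//].
(* The scalar is nonzero because C(n+1, 2) < (n + 1)^2. *)
rewrite subr_eq0 eqr_nat => /eqP E; have := mul_bin_left n.+1 1.
by rewrite -/c E bin1; nia.
Qed.

Lemma grad_cusp_Xn1 : cusp_form ('X^(n.-1) * cusp_unit) = 0.
Proof.
have := grad_cusp_curve (isT : (1 < 2)%N); rewrite coef_cusp_curve.
have -> : (n.+1 - 3 = n.-2)%N by lia.
have -> : (n.+1 - 2 = n.-1)%N by lia.
set c := 'C(n.+1, 3); set b := 'C(n.+1, 2).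
have -> : ('X * ((-1) ^+ 3 * 'X^(n.-2) * c%:R)
    + n.+1%:R * ((-1) ^+ 2 * 'X^(n.-1) * b%:R)) * cusp_unit =
    ((n.+1 * b)%:R - c%:R) *: ('X^(n.-1) * cusp_unit) :> {poly K}.
  have -> : 'X^(n.-1) = 'X * 'X^(n.-2) :> {poly K}.
    by rewrite -exprS; congr (_ ^+ _); lia.
  by rewrite -mul_polyC polyCB !polyC_natr natrM; ring.
rewrite -/(cusp_form _) cusp_formZ => /eqP; rewrite mulf_eq0 => /orP[|/eqP//].
have b0 : (0 < b)%N by rewrite bin_gt0; lia.
(* Since 3 C(n+1, 3) = (n - 1) C(n+1, 2), the two terms cannot balance. *)
rewrite subr_eq0 eqr_nat => /eqP E; have := mul_bin_left n.+1 2.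
by rewrite -/c -E -/b; nia.
Qed.

(** Multiples of X^(n+1), then X^n h and X^(n-1) h, are tangent. As h(0) is nonzero, this triangular
    system yields X^n and X^(n-1) themselves. *)
Lemma grad_cusp_delta (k : 'I_M) : (n.-1 <= k)%N -> grad G cusp (delta_mx 0 k) = 0.
Proof.
have -> : delta_mx 0 k = poly_rV 'X^k :> 'rV[K]_M.
  by rewrite -rVpoly_delta rVpolyK.
rewrite -/(cusp_form _); have M0 := ltn_ord k.
have ge (j : nat) : (n.+1 <= j)%N -> (j < M)%N -> cusp_form 'X^j = 0.
  move=> nj jM; rewrite -(subnKC nj) exprD; apply: grad_cusp_mul.
  by rewrite size_polyXn; lia.
have Eh : cusp_unit = cusp_unit`_0 *: 1 + 'X * drop_poly 1 cusp_unit.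
  rewrite -[LHS](poly_take_drop 1) expr1 [_ * 'X]mulrC; congr (_ + _).
  by apply/polyP => -[|j]; rewrite coef_take_poly coefZ coef1 ?mulr1 ?mulr0.
have sd l : (size (drop_poly l.+1 cusp_unit) <= M - n.+2)%N.
  by rewrite size_drop_poly size_cusp_unit; lia.
have En : cusp_form 'X^n = 0.
  have := grad_cusp_Xn; rewrite {1}Eh mulrDr -scalerAr mulr1 mulrA -exprSr cusp_form_linear.
  rewrite [X in _ + X](_ : _ = 0) ?addr0; last first.
    by apply: grad_cusp_mul; apply: leq_trans (sd 0%N) _; lia.
  by move/eqP; rewrite mulf_eq0 (negPf coef0_cusp_unit) => /eqP.
have Ed : drop_poly 1 cusp_unit = cusp_unit`_1 *: 1 + 'X * drop_poly 2 cusp_unit.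
  apply/polyP => j; rewrite coefD coefZ coef1 coefXM !coef_drop_poly.
  case: j => [|j]; rewrite ?addr0 ?mulr1 //= mulr0 add0r; congr (_`_ _); lia.
have En1 : cusp_form 'X^(n.-1) = 0.
  have := grad_cusp_Xn1; rewrite {1}Eh Ed !mulrDr -!scalerAr !mulr1 !mulrA -!exprSr.
  rewrite prednK ?(ltnW n2) // cusp_form_linear cusp_form_linear En mulr0 add0r.
  rewrite [X in _ + X](_ : _ = 0) ?addr0; last first.
    by apply: grad_cusp_mul; apply: leq_trans (sd 1%N) _; lia.
  by move/eqP; rewrite mulf_eq0 (negPf coef0_cusp_unit) => /eqP.
rewrite leq_eqVlt => /orP[/eqP <- //|]; rewrite prednK ?(ltnW n2) //.
by rewrite leq_eqVlt => /orP[/eqP <- //|nk]; apply: ge.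
Qed.

End Cusp.

(** * An equation with nonzero differential at the cusp *)

Section SymmetricEquation.
Variables M n : nat.

Section Def.
Variables (L : comNzRingType) (r : 'I_M -> L).

Definition spread (S : {set 'I_M}) e : L :=
  \sum_(i in S) \sum_(j in S) (r i - r j) ^+ e.

(** When n + 1 roots of S coincide and the last lies at distance s, the spread of even exponent e >
    0 is 2(n + 1) s^e, the factor counting the ordered pairs that contain the outlier; so this form
    vanishes. It plays the part of the relation between t^4 and (t^2)^2 on the cuspidal curve, made
    translation invariant by differences. *)
Definition outlier_form (S : {set 'I_M}) : L :=
  (n.+1).*2%:R * spread S 4 - spread S 2 ^+ 2.

Definition root_separation (S : {set 'I_M}) : L :=
  \prod_(j | j \notin S) \prod_(i | i != j) (r i - r j).

(* Vanishes when [n + 1] of the [r i] coincide: if they do not all lie in [S] then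
   [root_separation S = 0], and if they do then [outlier_form S = 0]. *)
Definition sym_equation : L :=
  \sum_(S : {set 'I_M} | #|S| == n.+2) outlier_form S * root_separation S ^+ 5.

End Def.

Lemma rmorph_spread (L L' : comNzRingType) (f : {rmorphism L -> L'}) r S e :
  f (spread r S e) = spread (f \o r) S e.
Proof.
rewrite rmorph_sum; apply: eq_bigr => i _; rewrite rmorph_sum; apply: eq_bigr => j _.
by rewrite rmorphXn rmorphB.
Qed.

Lemma rmorph_outlier_form (L L' : comNzRingType) (f : {rmorphism L -> L'}) r S :
  f (outlier_form r S) = outlier_form (f \o r) S.
Proof. by rewrite rmorphB rmorphM rmorphXn !rmorph_spread rmorph_nat. Qed.

Lemma rmorph_root_separation (L L' : comNzRingType) (f : {rmorphism L -> L'}) r S :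
  f (root_separation r S) = root_separation (f \o r) S.
Proof.
rewrite rmorph_prod; apply: eq_bigr => i _; rewrite rmorph_prod; apply: eq_bigr => j _.
by rewrite rmorphB.
Qed.

Lemma rmorph_sym_equation (L L' : comNzRingType) (f : {rmorphism L -> L'}) r :
  f (sym_equation r) = sym_equation (f \o r).
Proof.
rewrite rmorph_sum; apply: eq_bigr => S _.
by rewrite rmorphM rmorphXn rmorph_outlier_form rmorph_root_separation.
Qed.

Lemma eq_sym_equation (L : comNzRingType) (r r' : 'I_M -> L) :
  r =1 r' -> sym_equation r = sym_equation r'.
Proof. by move=> /funext ->. Qed.

Lemma sym_equation_perm (L : comNzRingType) (r : 'I_M -> L) (s : 'S_M) :
  sym_equation (r \o s) = sym_equation r.
Proof.
have sS (S : {set 'I_M}) i : (s i \in s @: S) = (i \in S).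
  by rewrite mem_imset //; apply: perm_inj.
rewrite [RHS](reindex_inj (imset_inj (@perm_inj _ s))).
apply: eq_big => [S|S _]; first by rewrite card_imset //; apply: perm_inj.
have E e : spread (r \o s) S e = spread r (s @: S) e.
  rewrite [RHS](reindex_inj (@perm_inj _ s)); apply: eq_big => [i|i _]; first by rewrite sS.
  by rewrite [RHS](reindex_inj (@perm_inj _ s)); apply: eq_bigl => j; rewrite sS.
congr (_ * _ ^+ _); first by rewrite /outlier_form !E.
rewrite [RHS](reindex_inj (@perm_inj _ s)); apply: eq_big => [i|i _]; first by rewrite sS.
rewrite [RHS](reindex_inj (@perm_inj _ s)); apply: eq_bigl => j.
by rewrite (inj_eq (@perm_inj _ s)).
Qed.

Lemma spread_outlier (L : comNzRingType) (r : 'I_M -> L) (S : {set 'I_M}) o z e :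
  #|S| = n.+2 -> o \in S -> (forall i, i \in S -> i != o -> r i = z) ->
  spread r S (e.+1).*2 = (n.+1).*2%:R * (z - r o) ^+ (e.+1).*2.
Proof.
move=> cS oS rz; have cSo : #|[pred i | i \in S & i != o]| = n.+1.
  have := cardsD1 o S; rewrite oS cS add1n => -[->]; apply: eq_card => i.
  by rewrite !inE andbC.
have sub0 : (0 : L) ^+ (e.+1).*2 = 0 by rewrite expr0n.
have sumc (c : L) : \sum_(i in S | i != o) c = c *+ n.+1 by rewrite sumr_const cSo.
have ev : (r o - z) ^+ (e.+1).*2 = (z - r o) ^+ (e.+1).*2.
  by rewrite -opprB exprNn -signr_odd odd_double expr0 mul1r.
rewrite /spread (bigD1 o) //= (bigD1 o) //= subrr sub0 add0r.
rewrite (eq_bigr (fun=> (z - r o) ^+ (e.+1).*2)); last first.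
  by move=> i /andP[iS io]; rewrite (rz i) // ev.
rewrite sumc (eq_bigr (fun=> (z - r o) ^+ (e.+1).*2)); last first.
  move=> i /andP[iS io]; rewrite (bigD1 o) //= (rz i) // big1 ?addr0 // => j /andP[jS jo].
  by rewrite (rz j) // subrr sub0.
by rewrite sumc -mulrnDr addnn mulr_natl.
Qed.

Lemma sym_equation_eq0 (F : fieldType) (r : 'I_M -> F) z : (0 < n)%N ->
  (n.+1 <= #|[set i | r i == z]|)%N -> sym_equation r = 0.
Proof.
move=> n0; set I := [set _ | _] => cI; apply: big1 => S /eqP cS.
have rI i : i \in I -> r i = z by rewrite inE => /eqP.
have [IS|/subsetPn[j jI jS]] := boolP (I \subset S); last first.
  rewrite [X in _ * X ^+ _](_ : _ = 0) ?expr0n ?mulr0 //.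
  apply/eqP/prodf_eq0; exists j => //; apply/prodf_eq0.
  have [i iI] : exists i, i \in I :\ j.
    by apply/card_gt0P; have := cardsD1 j I; rewrite jI; lia.
  by exists i; move: iI; rewrite in_setD1 => /andP[ij iI] //; rewrite !rI // subrr.
have [o oS So] : exists2 o, o \in S & forall i, i \in S -> i != o -> r i = z.
  have cD : (#|S :\: I| <= 1)%N by rewrite cardsD (finset.setIidPr IS) cS leq_subLR addn1.
  have [|/finset.set0Pn[o oD]] := eqVneq (S :\: I) finset.set0.
    (* All roots of [S] coincide, and any element may be called the outlier. *)
    move=> /eqP; rewrite finset.setD_eq0 => SI.
    have [o oI] : exists o, o \in I by apply/card_gt0P; lia.
    by exists o => [|i iS _]; [apply: (fintype.subsetP IS)|apply/rI/(fintype.subsetP SI)].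
  exists o => [|i iS io]; first by move: oD; rewrite inE => /andP[].
  apply: rI; apply: contraNT io => iI; apply/eqP.
  by apply: (card_le1_eqP cD) => //; rewrite inE iI.
have := @spread_outlier _ r S o z 1 cS oS So; have := @spread_outlier _ r S o z 0 cS oS So.
rewrite /outlier_form /= => -> ->; set c := _%:R.
by rewrite [X in X * _](_ : _ = 0) ?mul0r //; ring.
Qed.

End SymmetricEquation.

Section CuspEquation.
Variable K : numClosedFieldType.
Variables M n : nat.

(** This is the fundamental theorem on symmetric polynomials. The elementary symmetric function of
    index i + 1 is (-1)^(i+1) times the coefficient of X^(M-i-1), whence the reversed variables. *)
Lemma sym_equation_coef : exists F : {mpoly K[M]},
  forall (v : 'rV[K]_M) (r : 'I_M -> K), monic_poly_of v = \prod_i ('X - (r i)%:P) ->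
    F.@[v 0] = sym_equation n r.
Proof.
pose P : {mpoly K[M]} := sym_equation n (fun i => 'X_i).
have Psym : P \is symmetric.
  apply/issymP => s; rewrite [msym s P](rmorph_sym_equation _ (msym s)).
  rewrite -[RHS](sym_equation_perm n _ s); apply: eq_sym_equation => i /=.
  by rewrite /msym mmapX mmap1U.
exists (symf P \mPo [tuple (-1) ^+ i.+1 *: 'X_(rev_ord i) | i < M]) => v r Ev.
have -> : sym_equation n r = P.@[r].
  rewrite [RHS](rmorph_sym_equation _ (meval r)); apply: eq_sym_equation => i /=.
  by rewrite mevalXU.
rewrite [in RHS](symfP Psym) !comp_mpoly_meval; apply: meval_eq => i.
rewrite !tnth_mktuple mevalZ mevalXU.
have := mroots_coeff [tuple r i | i < M] (lift ord0 i).
rewrite big_tuple (eq_bigr (fun i => 'X - (r i)%:P)) => [|j _]; last by rewrite tnth_mktuple.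
rewrite -Ev /= /bump /= add1n.
have -> : (monic_poly_of v)`_(M - i.+1) = v 0 (rev_ord i).
  rewrite -[(M - i.+1)%N]/(val (rev_ord i)) coefD coefXn coef_rVpoly_ord.
  by rewrite (ltn_eqF (ltn_ord _)) add0r.
move=> ->; rewrite signrMK; apply: meval_eq => j.
by rewrite tnth_mktuple.
Qed.

Lemma sym_equation_vanishes F : (0 < n)%N ->
  (forall (v : 'rV[K]_M) (r : 'I_M -> K), monic_poly_of v = \prod_i ('X - (r i)%:P) ->
    F.@[v 0] = sym_equation n r) ->
  vanishes_on (~` Poly_var K M n.+1)%classic F.
Proof.
move=> n0 HF v /contrapT[z]; rewrite -[monic_of v]/(monic_poly_of v) => mz.
have [s] := closed_field_poly_normal (monic_poly_of v).
rewrite (monicP (monic_poly_ofP v)) scale1r => Es.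
have ss : size s = M.
  by have := size_monic_poly_of v; rewrite Es size_prod_XsubC => -[].
have Er : monic_poly_of v = \prod_(i < M) ('X - (nth 0 s i)%:P).
  by rewrite Es (big_nth 0) ss big_mkord.
rewrite (HF _ _ Er); apply: (@sym_equation_eq0 _ _ _ _ z) => //.
apply: leq_trans mz _; rewrite Es mu_prod_XsubC -sum1_count (big_nth 0) ss big_mkord sum1_card.
by rewrite cardsE.
Qed.

End CuspEquation.

(** * A path through the cusp on which the equation has order exactly four *)

Section CuspPath.
Variable K : numClosedFieldType.
Variables M n : nat.
Hypotheses (n2 : (1 < n)%N) (nM : (n.+2 < M)%N).

(** The default 0 of [nth] supplies the n - 2 roots that stay at 0 along the path. *)
Definition quartic_root (i : nat) : K := nth 0 [:: 1; 'i; -1; - 'i] i.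

(* The roots of [(X^4 - T^4) X^(n-2) h], where [X^(n+2) h = cusp_poly]. *)
Definition cusp_path_root (i : 'I_M) : {poly K} :=
  if (i < n.+2)%N then (quartic_root i)%:P * 'X else (i%:R)%:P.

Lemma quartic_prod (t : K) :
  \prod_(0 <= i < 4) ('X - (quartic_root i * t)%:P) = 'X^4 - (t ^+ 4)%:P.
Proof.
rewrite !big_nat_recl // big_nil /quartic_root /= mulr1 !mul1r.
rewrite !mulNr !polyCN mul1r polyCM polyC_exp; set y := t%:P; set j := 'i%:P.
have jj : j * j = -1 by rewrite -polyCM -expr2 sqrCi polyCN.
by transitivity (('X - y) * ('X + y) * ('X * 'X - j * j * (y * y))); [ring | rewrite jj; ring].
Qed.

Lemma monic_cusp_path t :
  monic_poly_of (cusp K M n + t ^+ 4 *: poly_rV (- ('X^(n.-2) * cusp_unit K M n))) =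
  \prod_i ('X - ((cusp_path_root i).[t])%:P).
Proof.
pose f i : {poly K} := if (i < n.+2)%N then 'X - (quartic_root i * t)%:P else 'X - (i%:R)%:P.
rewrite (eq_bigr (fun i : 'I_M => f i)); last first.
  by move=> i _; rewrite /f /cusp_path_root; case: ifP => _; rewrite !hornerE.
rewrite -(big_mkord xpredT f) (@big_cat_nat _ _ _ n.+2) //=; last exact: ltnW.
have -> : \prod_(n.+2 <= i < M) f i = cusp_unit K M n.
  by apply: eq_big_nat => i /andP[ni _]; rewrite /f ltnNge ni.
rewrite (@big_cat_nat _ _ _ 4) //=.
rewrite (_ : \prod_(0 <= i < 4) f i = 'X^4 - (t ^+ 4)%:P); last first.
  rewrite -(quartic_prod t); apply: eq_big_nat => i /andP[_ i4].
  by rewrite /f (leq_trans i4).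
rewrite (_ : \prod_(4 <= i < n.+2) f i = 'X^(n.-2)); last first.
  rewrite (eq_big_nat _ _ (F2 := fun=> 'X)) ?prodr_const_nat; first by congr (_ ^+ _); lia.
  move=> i /andP[i4 ni]; rewrite /f ni /quartic_root nth_default // mul0r polyC0 subr0 //.
rewrite monic_poly_ofD monic_poly_of_cusp // poly_rV_K; last first.
  rewrite size_polyN; apply: leq_trans (size_polyM_le (leqnn _) (leqnn _)) _.
  by rewrite size_polyXn size_cusp_unit //; lia.
rewrite /cusp_poly -mul_polyC (_ : 'X^(n.+2) = 'X^4 * 'X^(n.-2)); first by ring.
by rewrite -exprD; congr (_ ^+ _); lia.
Qed.

Let Z : {set 'I_M} := [set i : 'I_M | (i < n.+2)%N].

Lemma card_low_set : #|Z| = n.+2.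
Proof.
rewrite cardsE -sum1_card -(big_ord_widen _ (fun=> 1%N)); last exact: ltnW.
by rewrite sum1_card card_ord.
Qed.

Lemma sum_quartic (F : K -> K) : F 0 = 0 ->
  \sum_(i in Z) F (quartic_root i) = F 1 + F 'i + F (-1) + F (- 'i).
Proof.
move=> F0; rewrite (eq_bigl (fun i : 'I_M => (i < n.+2)%N)); last by move=> i; rewrite inE.
rewrite -(big_ord_widen _ (fun i => F (quartic_root i))); last exact: ltnW.
case: n n2 => [|[|k]] // _; rewrite !big_ord_recl big1 ?addr0 /quartic_root /= ?addrA //.
by move=> i _; rewrite /= nth_default.
Qed.

Lemma sum_sub_quartic2 x : \sum_(j in Z) (x - quartic_root j) ^+ 2 = (n.+2)%:R * x ^+ 2.
Proof.
rewrite (eq_bigr (fun j : 'I_M => x ^+ 2 + (- 2 * x * quartic_root j + quartic_root j ^+ 2))); last first.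
  by move=> j _; ring.
rewrite !big_split sumr_const card_low_set -mulr_natl -mulr_sumr /=.
have -> : \sum_(j in Z) quartic_root j = 0 by rewrite (sum_quartic (F := id)) //; ring.
have -> : \sum_(j in Z) quartic_root j ^+ 2 = 0.
  by rewrite (sum_quartic (F := fun y => y ^+ 2)) ?expr0n // !sqrrN sqrCi expr1n; ring.
by ring.
Qed.

Lemma sum_sub_quartic4 x : \sum_(j in Z) (x - quartic_root j) ^+ 4 = (n.+2)%:R * x ^+ 4 + 4.
Proof.
rewrite (eq_bigr (fun j : 'I_M => x ^+ 4 + (- 4 * x ^+ 3 * quartic_root j + (6 * x ^+ 2 * quartic_root j ^+ 2
   + (- 4 * x * quartic_root j ^+ 3 + quartic_root j ^+ 4))))); last first.
  by move=> j _; ring.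
rewrite !big_split sumr_const card_low_set -mulr_natl -!mulr_sumr /=.
have ii : 'i * 'i = -1 :> K by rewrite -expr2 sqrCi.
have -> : \sum_(j in Z) quartic_root j = 0 by rewrite (sum_quartic (F := id)) //; ring.
have -> : \sum_(j in Z) quartic_root j ^+ 2 = 0.
  by rewrite (sum_quartic (F := fun y => y ^+ 2)) ?expr0n // !sqrrN sqrCi expr1n; ring.
have -> : \sum_(j in Z) quartic_root j ^+ 3 = 0.
  by rewrite (sum_quartic (F := fun y => y ^+ 3)) ?expr0n //; ring.
have -> : \sum_(j in Z) quartic_root j ^+ 4 = 4.
  rewrite (sum_quartic (F := fun y => y ^+ 4)) ?expr0n //.
  by transitivity (2 + 2 * (('i * 'i) * ('i * 'i)) : K); [ring | rewrite ii; ring].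
by ring.
Qed.

Lemma spread_cusp_path e : spread cusp_path_root Z e =
  (\sum_(i in Z) \sum_(j in Z) (quartic_root i - quartic_root j) ^+ e)%:P * 'X^e.
Proof.
rewrite rmorph_sum mulr_suml; apply: eq_bigr => i iZ.
rewrite rmorph_sum mulr_suml; apply: eq_bigr => j jZ /=.
move: iZ jZ; rewrite !inE /cusp_path_root => -> ->.
by rewrite -mulrBl exprMn -polyCB polyC_exp.
Qed.

(** The fourth roots of unity have power sums 0, 0, 0, 4, so the spread of exponent 2 vanishes and
    that of exponent 4 is 8(n + 2) T^4. *)
Lemma outlier_form_cusp_path : outlier_form n cusp_path_root Z =
  ((n.+1).*2 * (n.+2 * 8))%:R%:P * 'X^4.
Proof.
rewrite /outlier_form !spread_cusp_path.
rewrite (eq_bigr (fun i : 'I_M => (n.+2)%:R * quartic_root i ^+ 4 + 4)); last first.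
  by move=> i _; rewrite sum_sub_quartic4.
rewrite [X in _ - (X%:P * _) ^+ _](_ : _ = 0); last first.
  rewrite (eq_bigr (fun i : 'I_M => (n.+2)%:R * quartic_root i ^+ 2)); last first.
    by move=> i _; rewrite sum_sub_quartic2.
  rewrite -mulr_sumr (eq_bigr (fun i : 'I_M => (0 - quartic_root i) ^+ 2)).
    by rewrite sum_sub_quartic2 expr0n !mulr0.
  by move=> i _; rewrite sub0r sqrrN.
rewrite mul0r expr0n subr0 big_split /= -mulr_sumr (eq_bigr (fun i : 'I_M => (0 - quartic_root i) ^+ 4)); last first.
  by move=> i _; rewrite sub0r exprNn -signr_odd mul1r.
rewrite sum_sub_quartic4 expr0n mulr0 add0r sumr_const card_low_set mulrA; congr (_ * _).
by rewrite -polyC_natr -polyCM -mulr_natl !natrM; congr (_%:P); ring.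
Qed.

Lemma sym_equation_cusp_path : exists2 g : {poly K},
  sym_equation n cusp_path_root = 'X^4 * g & g.[0] != 0.
Proof.
set b := root_separation cusp_path_root Z.
have b0 : b.[0] != 0.
  rewrite -[b.[0]]/(horner_eval 0 b) rmorph_root_separation.
  apply/prodf_neq0 => j; rewrite inE -leqNgt => nj; apply/prodf_neq0 => i ij /=.
  rewrite /cusp_path_root /horner_eval [(j < _)%N]ltnNge nj /= hornerC subr_eq0.
  case: ifP => _; rewrite !hornerE ?eqr_nat // eq_sym pnatr_eq0.
  by rewrite -lt0n (leq_trans _ nj).
(* Some j in [Z] is missing from [S], and for another i in [Z] the factor r i - r j of
   [root_separation] is divisible by X. The fifth power then beats the order four of the term of
   [Z], hence the exponent 5 in [sym_equation]. *)
have H (S : {set 'I_M}) : #|S| == n.+2 -> S != Z ->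
    exists h, outlier_form n cusp_path_root S * root_separation cusp_path_root S ^+ 5 = 'X^4 * ('X * h).
  move=> /eqP cS SZ.
  have /fintype.subsetPn[j jZ jS] : ~~ (Z \subset S).
    by apply: contraNN SZ => ZS; rewrite eq_sym eqEcard ZS cS card_low_set /=.
  have [i iZ] : exists i, i \in Z :\ j.
    by apply/card_gt0P; have := cardsD1 j Z; rewrite jZ card_low_set; lia.
  move: iZ; rewrite in_setD1 => /andP[ij iZ].
  have [h Eh] : exists h, root_separation cusp_path_root S = 'X * h.
    rewrite /root_separation (bigD1 j) //= (bigD1 i) //=.
    move: iZ jZ; rewrite !inE {1 2}/cusp_path_root => -> ->.
    by rewrite -mulrBl [_ * 'X]mulrC -!mulrA; eexists.
  by exists (outlier_form n cusp_path_root S * h ^+ 5); rewrite Eh; ring.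
have [h Eh] : exists h, \sum_(S : {set 'I_M} | (#|S| == n.+2) && (S != Z))
    outlier_form n cusp_path_root S * root_separation cusp_path_root S ^+ 5 = 'X^4 * ('X * h).
  elim/big_ind: _ => [|_ _ [h1 ->] [h2 ->]|S /andP[cS SZ]].
  - by exists 0; rewrite !mulr0.
  - by exists (h1 + h2); rewrite !mulrDr.
  exact: H.
exists (((n.+1).*2 * (n.+2 * 8))%:R%:P * b ^+ 5 + 'X * h).
  rewrite /sym_equation (bigD1 Z) ?card_low_set //= Eh outlier_form_cusp_path -/b; ring.
rewrite hornerD hornerM hornerC horner_exp [X in _ + X]hornerM hornerX mul0r addr0.
by rewrite mulf_neq0 ?expf_neq0 // pnatr_eq0; lia.
Qed.

(** The path displaces the coefficients by t^4 v exactly, with v = -X^(n-2) h, so the coefficient of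
    t^4 in the equation along it is the gradient applied to v. *)
Lemma exists_grad_cusp_neq0 : exists2 F : {mpoly K[M]},
  vanishes_on (~` Poly_var K M n.+1)%classic F & exists v, grad F (cusp K M n) v != 0.
Proof.
have [F EF] := sym_equation_coef K M n.
have F0 := sym_equation_vanishes (ltnW n2) EF.
exists F => //; set v := poly_rV (- ('X^(n.-2) * cusp_unit K M n)) : 'rV_M; exists v.
have [g Eg g0] := sym_equation_cusp_path.
have [h Eh] := taylor1 F (cusp K M n) (fun i => (v 0 i)%:P) 4.
have : mmap polyC (fun i => (cusp K M n 0 i)%:P + 'X^4 * (v 0 i)%:P) F = 'X^4 * g.
  apply: horner_eq_poly => t; rewrite -Eg mmap_polyC_horner.
  rewrite -[RHS]/(horner_eval t _) rmorph_sym_equation -(EF _ _ (monic_cusp_path t)).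
  by apply: meval_eq => i; rewrite !mxE !hornerE.
rewrite Eh F0 ?polyC0 ?add0r; last first.
  by apply: (@cusp_in _ _ _ ('X * cusp_unit K M n) _ 0);
    rewrite monic_poly_of_cusp // subr0 mulrA -exprSr.
rewrite -mulrA -mulrDr => /mulfI; rewrite expf_eq0 polyX_eq0 => /(_ isT).
move=> /(congr1 (horner_eval 0)); rewrite /horner_eval hornerD [X in _ + X]hornerM hornerXn expr0n mul0r addr0.
rewrite horner_sum (_ : \sum_i _ = grad F (cusp K M n) v); first by move=> ->.
by apply: eq_bigr => i _; rewrite !hornerE.
Qed.

End CuspPath.

(** * The singularities of the common-root variety *)

Section RatSide.
Variable K : numClosedFieldType.
Variables d n : nat.
Hypothesis d2 : (1 < d)%N.

Local Notation R := (~` Rat_var K d n)%classic.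

Lemma common_root_in (x : 'rV[K]_(n.+1 * d)) z : (forall i, root (rat_comp x i) z) -> R x.
Proof. by move=> xz; apply; exists z. Qed.

Lemma grad_common_root G (x v : 'rV[K]_(n.+1 * d)) z : vanishes_on R G ->
  (forall i, root (rat_comp x i) z) -> (forall i, root (rat_dir v i) z) -> grad G x v = 0.
Proof.
move=> GR xz vz; apply: (grad_line_eq0 GR) => t; apply: (common_root_in (z := z)) => i.
by rewrite rat_compD rootE hornerD hornerZ (rootP (xz i)) (rootP (vz i)) mulr0 addr0.
Qed.

Lemma rat_dirD (u v : 'rV[K]_(n.+1 * d)) t i :
  rat_dir (t *: u + v) i = t *: rat_dir u i + rat_dir v i.
Proof. by rewrite /rat_dir !linearP. Qed.

Lemma rat_dirE (v : 'rV[K]_(n.+1 * d)) : v = rat_vec d (rat_dir v).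
Proof.
rewrite /rat_vec -[LHS]vec_mxK; congr mxvec; apply/row_matrixP => i.
by rewrite rowK /rat_dir rVpolyK.
Qed.

(** At x + s beta both a and b + s are common roots, and a vector whose components all vanish at a,
    or all at b + s, is tangent. The difference of X - a and X - (b + s) is the constant s + b - a,
    so s + b - a times the gradient along constants is 0 for all s. As polynomials in s the factor
    cancels, and s = 0 is allowed even if a = b. *)
Lemma grad_double_common_factor G (x : 'rV[K]_(n.+1 * d)) (h : 'I_n.+1 -> {poly K}) a b v :
  vanishes_on R G -> (forall i, rat_comp x i = ('X - a%:P) * ('X - b%:P) * h i) ->
  grad G x v = 0.
Proof.
move=> GR Ex.
have sh i : (size (('X - a%:P) * h i)%R <= d)%N.
  have h0 : h i != 0.
    apply/eqP => h0; have := size_rat_comp x i; rewrite Ex h0 mulr0 size_poly0 //.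
  have nz : ('X - a%:P) * h i != 0 by rewrite mulf_neq0 ?polyXsubC_eq0.
  have E := size_rat_comp x i.
  rewrite Ex mulrAC mulrC size_monicM ?monicXsubC // size_XsubC /= in E.
  by case: E => <-.
pose beta : 'rV[K]_(n.+1 * d) := rat_vec d (fun i => - (('X - a%:P) * h i)).
have Eb i : rat_dir beta i = - (('X - a%:P) * h i) by rewrite rat_dir_vec ?size_polyN.
have Es s i : rat_comp (x + s *: beta) i = ('X - a%:P) * ('X - (b + s)%:P) * h i.
  by rewrite rat_compD Ex Eb polyCD -mul_polyC; ring.
pose c i := (rat_dir v i).[a].
pose v1 (e : {poly K}) : 'rV[K]_(n.+1 * d) := rat_vec d (fun i => (c i)%:P * e).
have sc i (e : {poly K}) : (size e <= 2)%N -> (size ((c i)%:P * e)%R <= d)%N.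
  by move=> se; rewrite mul_polyC (leq_trans (size_scale_leq _ _)) // (leq_trans se).
have v1E (e : {poly K}) i : (size e <= 2)%N -> rat_dir (v1 e) i = (c i)%:P * e.
  by move=> se; rewrite rat_dir_vec ?sc.
(* The values of [v] at a, taken as constants, plus a vector whose components vanish at a. *)
have Ev : v = 1 *: v1 1 + (-1 *: v1 1 + v) by rewrite scaleN1r scale1r addNKr.
rewrite {}Ev grad_is_linear mul1r.
rewrite [X in _ + X](@grad_common_root _ _ _ a GR) ?addr0; first last.
- move=> i; rewrite rat_dirD v1E ?size_poly1 // mulr1 rootE hornerD hornerZ hornerC.
  by rewrite mulN1r addNr.
- by move=> i; rewrite Ex !rootM root_XsubC eqxx.
pose U := \sum_i (v1 1 0 i)%:P * mmap polyC (fun l => (x 0 l)%:P + 'X * (beta 0 l)%:P) G^`M(i).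
have UE s : U.[s] = grad G (x + s *: beta) (v1 1).
  rewrite horner_sum; apply: eq_bigr => i _; rewrite hornerM hornerC mmap_polyC_horner.
  by congr (_ * _); apply: meval_eq => l; rewrite !mxE !hornerE.
suff U0 : U = 0 by have := UE 0; rewrite U0 horner0 scale0r addr0.
have nz : 'X + (b - a)%:P != 0 :> {poly K}.
  by rewrite -size_poly_eq0 -[(b - a)%:P]opprK -polyCN size_XsubC.
apply: (mulfI nz); rewrite mulr0; apply: horner_eq_poly => s.
rewrite hornerM hornerD hornerX hornerC UE horner0.
have ga : grad G (x + s *: beta) (v1 ('X - a%:P)) = 0.
  apply: (grad_common_root (z := a) GR) => i.
    by rewrite Es !rootM root_XsubC eqxx.
  by rewrite v1E ?size_XsubC // rootM root_XsubC eqxx orbT.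
have gb : grad G (x + s *: beta) (v1 ('X - (b + s)%:P)) = 0.
  apply: (grad_common_root (z := b + s) GR) => i.
    by rewrite Es !rootM !root_XsubC eqxx orbT.
  by rewrite v1E ?size_XsubC // rootM root_XsubC eqxx orbT.
have : grad G (x + s *: beta) ((s + (b - a)) *: v1 1 + v1 ('X - (b + s)%:P)) = 0.
  rewrite -[RHS]ga; congr grad; rewrite [LHS]rat_dirE [RHS]rat_dirE; congr (rat_vec d _); apply/funext => i.
  rewrite rat_dirD !v1E ?size_XsubC ?size_poly1 //.
  by rewrite -mul_polyC !polyCD polyCN; ring.
by rewrite grad_is_linear gb addr0.
Qed.

End RatSide.

(** * Tangent vectors at a simple common root *)

Section Bezout.
Variables (K : numClosedFieldType) (n : nat).

Lemma bezout_family (g : 'I_n.+1 -> {poly K}) :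
  (forall w, ~ forall i, root (g i) w) -> exists lam, \sum_i lam i * g i = 1.
Proof.
move=> nocommon.
have H (s : seq 'I_n.+1) : exists D lam, \sum_i lam i * g i = D /\ forall i, i \in s -> D %| g i.
  elim: s => [|k s [D [lam [ED Ds]]]].
    by exists 0, (fun=> 0); split=> //; rewrite big1 // => i _; rewrite mul0r.
  have [[u v] /= uv] := Bezoutp D (g k).
  exists (u * D + v * g k), (fun i => u * lam i + (if i == k then v else 0)); split.
    rewrite (eq_bigr (fun i => u * (lam i * g i) + (if i == k then v * g i else 0))).
      by rewrite big_split /= -mulr_sumr ED -big_mkcond big_pred1_eq.
    by move=> i _; rewrite mulrDl mulrA; case: ifP => _; rewrite ?mul0r.
  move=> i; rewrite (eqp_dvdl _ uv) inE => /orP[/eqP ->|/Ds Di]; first exact: dvdp_gcdr.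
  exact: dvdp_trans (dvdp_gcdl _ _) Di.
have [D [lam [ED Ds]]] := H (enum 'I_n.+1).
have {}Ds i : D %| g i by apply: Ds; rewrite mem_enum.
have : size D == 1%N.
  apply: contraT => /closed_rootP[w Dw]; case: (nocommon w) => i.
  by have /dvdpP[h ->] := Ds i; rewrite rootM Dw orbT.
move=> /size_poly1P[c c0 Dc]; exists (fun i => c^-1%:P * lam i).
rewrite (eq_bigr (fun i => c^-1%:P * (lam i * g i))); last by move=> i _; rewrite mulrA.
by rewrite -mulr_sumr ED Dc -polyCM mulVf.
Qed.

End Bezout.

Section BorderedDet.

(** The Sylvester matrix for formal degrees m + 1 and k, with its last row X^m b replaced by c. *)
Definition bordered_row (L : nzRingType) k m (a b c : {poly L}) (i : 'I_(k + m + 1)) : {poly L} :=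
  match split i with inl j => sylvester_row a b j | inr _ => c end.

Definition bordered_det (L : comNzRingType) k m (a b c : {poly L}) : L :=
  \det (coef_mx (@bordered_row L k m a b c)).

Lemma map_bordered_det (L L' : comNzRingType) (f : {rmorphism L -> L'}) k m (a b c : {poly L}) :
  f (bordered_det k m a b c) =
  bordered_det k m (map_poly f a) (map_poly f b) (map_poly f c).
Proof.
rewrite /bordered_det -det_map_mx map_coef_mx; congr (\det _).
apply/matrixP => i j; rewrite !mxE /bordered_row; case: split => // l.
by rewrite map_sylvester_row.
Qed.

Lemma bordered_detZ (L : comNzRingType) k m (a b c : {poly L}) t :
  bordered_det k m a b (t *: c) = t * bordered_det k m a b c.
Proof.
set A := coef_mx (@bordered_row L k m a b c).
have := @determinant_multilinear _ _ (coef_mx (bordered_row a b (t *: c))) A A (rshift (k + m) ord0) t 0.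
rewrite mul0r addr0; apply.
- apply/rowP => j; rewrite !mxE /bordered_row (unsplitK (inr _ ord0)) coefZ mul0r addr0 //.
- apply/matrixP => i j; rewrite !mxE /bordered_row.
  by case: splitP => // l El; case/eqP: (neq_lift (rshift (k + m) ord0) i);
    apply: ord_inj; rewrite [RHS]El (ord1 l).
- apply/matrixP => i j; rewrite !mxE /bordered_row.
  by case: splitP => // l El; case/eqP: (neq_lift (rshift (k + m) ord0) i);
    apply: ord_inj; rewrite [RHS]El (ord1 l).
Qed.

Variables (F : fieldType) (k m : nat).

Lemma size_bordered_row (a b c : {poly F}) i :
  (size a <= m.+2)%N -> (size b <= k.+1)%N -> (size c <= k + m + 1)%N ->
  (size (@bordered_row F k m a b c i) <= k + m + 1)%N.
Proof.
move=> sa sb sc; rewrite /bordered_row; case: split => // j.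
rewrite /sylvester_row; case: split => l; have := ltn_ord l => lk.
  by apply: leq_trans (size_polyM_le (leqnn _) sa) _; rewrite size_polyXn; lia.
by apply: leq_trans (size_polyM_le (leqnn _) sb) _; rewrite size_polyXn; lia.
Qed.

Lemma bordered_det_root (a b c : {poly F}) z :
  (size a <= m.+2)%N -> (size b <= k.+1)%N -> (size c <= k + m + 1)%N ->
  root a z -> root b z -> root c z -> bordered_det k m a b c = 0.
Proof.
move=> sa sb sc az bz cz; apply: (det_coef_mx_root (z := z)) => [|i|i].
- by rewrite addn1.
- exact: size_bordered_row.
rewrite /bordered_row; case: split => // j.
by rewrite /sylvester_row; case: split => l; rewrite rootM ?az ?bz orbT.
Qed.

(** The Sylvester rows are X - z times a basis of the polynomials of degree below k + m, so they
    span the multiples of X - z of degree at most k + m, and c is not among these. *)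
Lemma bordered_det_neq0 (g c : {poly F}) z : (0 < k)%N ->
  size g = m.+1 -> (size c <= k + m + 1)%N -> ~~ root c z ->
  bordered_det k m (('X - z%:P) * g) ('X - z%:P) c != 0.
Proof.
move=> k0 sg sc cz.
have g0 : g != 0 by rewrite -size_poly_eq0 sg.
apply: det_coef_mx_neq0 => [i|u].
  apply: size_bordered_row => //; last by rewrite size_XsubC.
  by rewrite size_monicM ?monicXsubC // size_XsubC sg.
rewrite big_split_ord /= big_ord1 {2}/bordered_row (unsplitK (inr _ ord0)).
rewrite (eq_bigr (fun i => lsubmx u 0 i *: sylvester_row (('X - z%:P) * g) ('X - z%:P) i)); last first.
  by move=> i _; rewrite /bordered_row (unsplitK (inl _ i)) mxE.
rewrite sum_sylvester_row; set A := rVpoly _; set B := rVpoly _ => E.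
have r0 : u 0 (rshift (k + m) ord0) = 0.
  have := congr1 (fun p : {poly F} => p.[z]) E.
  rewrite hornerD hornerZ hornerD !hornerM hornerXsubC subrr mul0r !mulr0 !add0r horner0 => /eqP.
  by rewrite mulf_eq0 [_ == 0 as X in _ || X](negPf cz) orbF => /eqP.
move: E; rewrite r0 scale0r addr0 => E.
have {}E : A * g + B = 0.
  apply: (mulfI (_ : 'X - z%:P != 0)); first by rewrite polyXsubC_eq0.
  by rewrite mulr0 -E; ring.
have A0 : A = 0.
  apply/eqP; apply: contraT => nz.
  have : size (A * g) = size B by rewrite -[A * g](addrK B) E sub0r size_polyN.
  rewrite size_mul // sg addnS /= => sB.
  have : (size B <= m)%N := size_poly _ _.
  by rewrite -sB -[X in (_ <= X)%N]add0n leq_add2r leqn0 size_poly_eq0 (negPf nz).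
have B0 : B = 0 by move: E; rewrite A0 mul0r add0r.
apply/rowP => i; rewrite mxE; case: (splitP i) => [j Ej|j Ej].
  have -> : i = lshift 1 j by apply: val_inj.
  have : lsubmx u = 0.
    rewrite -[lsubmx u]hsubmxK -[lsubmx (lsubmx u)]rVpolyK -[rsubmx (lsubmx u)]rVpolyK.
    rewrite -/A -/B A0 B0; apply/rowP => l; rewrite !mxE.
    by case: split => ?; rewrite mxE coef0.
  by move=> /rowP/(_ j); rewrite !mxE.
by rewrite -r0; congr (u 0 _); apply: val_inj; rewrite /= Ej ord1.
Qed.

End BorderedDet.

Section TangentEquation.
Variables d n : nat.

Definition combination (L : comNzRingType) (lam F : 'I_n.+1 -> {poly L}) : {poly L} :=
  \sum_i lam i * F i.

(* Vanishes when the components of [u] have a common root, since all rows then do.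
   At [u_i = (X - z) g_i] with [combination lam g = 1] the last row is zero, so the
   differential only sees the variation of that row. *)
Definition tangent_det (L : comNzRingType) e (lam : 'I_n.+1 -> {poly L}) (g : {poly L}) j
    (u : 'rV[L]_(n.+1 * d)) : L :=
  let b := combination lam (rat_comp u) in
  bordered_det e d.-1 (rat_comp u j) b (g * b - rat_comp u j).

Lemma map_combination (L L' : comNzRingType) (f : {rmorphism L -> L'}) (lam F : 'I_n.+1 -> {poly L}) :
  map_poly f (combination lam F) =
  combination (fun i => map_poly f (lam i)) (fun i => map_poly f (F i)).
Proof. by rewrite rmorph_sum; apply: eq_bigr => i _; rewrite rmorphM. Qed.

Lemma map_tangent_det (L L' : comNzRingType) (f : {rmorphism L -> L'}) e lam g j
    (u : 'rV[L]_(n.+1 * d)) :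
  f (tangent_det e lam g j u) =
  tangent_det e (fun i => map_poly f (lam i)) (map_poly f g) j (map_mx f u).
Proof.
rewrite /tangent_det map_bordered_det rmorphB rmorphM /= map_combination map_rat_comp.
by congr bordered_det; rewrite /combination; do ?[congr (_ * _ - _)];
  apply: eq_bigr => i _; rewrite map_rat_comp.
Qed.

Variable K : numClosedFieldType.
Hypothesis d0 : (0 < d)%N.
Local Notation R := (~` Rat_var K d n)%classic.

Variables (q v : 'rV[K]_(n.+1 * d)) (z : K) (g lam : 'I_n.+1 -> {poly K}).
Hypotheses (Eq : forall i, rat_comp q i = ('X - z%:P) * g i)
  (lam1 : combination lam g = 1)
  (tangent_v : forall G, vanishes_on R G -> grad G q v = 0).

Let e := (\max_i size (lam i) + d)%N.

Let size_comb (F : 'I_n.+1 -> {poly K}) : (forall i, size (F i) <= d.+1)%N ->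
  (size (combination lam F) <= e.+1)%N.
Proof.
move=> sF; apply: (big_ind (fun p : {poly K} => (size p <= e.+1)%N)) => [|a b sa sb|i _].
- by rewrite size_poly0.
- by rewrite (leq_trans (size_polyD _ _)) // geq_max sa.
apply: leq_trans (size_polyM_le (leqnn _) (sF i)) _.
by rewrite addnS /= (leq_trans _ (leqnSn _)) // leq_add2r (leq_bigmax i).
Qed.

Let size_g i : size (g i) = d.
Proof.
have g0 : g i != 0.
  by apply/eqP => g0; have := size_rat_comp q i; rewrite Eq g0 mulr0 size_poly0.
have E := size_rat_comp q i; rewrite Eq size_monicM ?monicXsubC // size_XsubC in E.
by case: E.
Qed.

Let size_border j (F : 'I_n.+1 -> {poly K}) : (forall i, size (F i) <= d.+1)%N ->
  (size (g j * combination lam F - F j)%R <= e + d.-1 + 1)%N.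
Proof.
move=> sF; rewrite (leq_trans (size_polyD _ _)) // geq_max size_polyN; apply/andP; split.
  by apply: leq_trans (size_polyM_le (leqnn _) (size_comb sF)) _; rewrite size_g; lia.
by apply: leq_trans (sF j) _; lia.
Qed.

Lemma tangent_det_vanishes j (u : 'rV[K]_(n.+1 * d)) : R u -> tangent_det e lam (g j) j u = 0.
Proof.
move=> /contrapT[w uw].
have sF i : (size (rat_comp u i) <= d.+1)%N by rewrite size_rat_comp.
have bw : root (combination lam (rat_comp u)) w.
  rewrite rootE horner_sum big1 // => i _.
  by rewrite hornerM [X in _ * X](rootP (uw i)) mulr0.
apply: (bordered_det_root (z := w)) => //.
- by rewrite size_rat_comp prednK.
- exact: size_comb.
- exact: size_border.
- exact: uw.
by rewrite rootE hornerD hornerN hornerM (rootP bw) [X in _ - X](rootP (uw j)) mulr0 subrr.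
Qed.

(** One scalar serves for all j: the vector of the v_j(z) lies on the line spanned by the nonzero
    vector of the g_j(z), so the tangent space has codimension at least n. *)
Lemma combination_tangent j :
  (rat_dir v j).[z] = (g j).[z] * (combination lam (rat_dir v)).[z].
Proof.
set om := g j * combination lam (rat_dir v) - rat_dir v j.
suff : root om z by rewrite rootE hornerD hornerN hornerM subr_eq0 => /eqP.
pose G : {mpoly K[(n.+1 * d)]} := tangent_det e (fun i => map_poly (@mpolyC _ K) (lam i))
   (map_poly (@mpolyC _ K) (g j)) j (\row_i 'X_i).
have GE (u : 'rV[K]_(n.+1 * d)) : G.@[u 0] = tangent_det e lam (g j) j u.
  rewrite [LHS](map_tangent_det (meval (u 0))).
  have mapK (p : {poly K}) : map_poly (meval (u 0)) (map_poly (@mpolyC (n.+1 * d) K) p) = p.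
    by rewrite -map_poly_comp map_poly_id // => c _ /=; rewrite mevalC.
  congr tangent_det; first by apply/funext => i; rewrite mapK.
    by rewrite mapK.
  by apply/rowP => i; rewrite !mxE /= mevalXU.
have GR : vanishes_on R G by move=> u Ru; rewrite GE tangent_det_vanishes.
have := tangent_v GR.
pose c i : {poly K} := (q 0 i)%:P + 'X * (v 0 i)%:P.
rewrite -(@coef1_mmap _ _ _ _ _ (fun i => (v 0 i)%:P)); last by move=> i; rewrite coefC.
rewrite -/c [mmap _ _ _](map_tangent_det (mmap polyC c)).
(* The inner variable of [{poly {poly K}}] is here the path parameter, the outer one the variable of
   the components. *)
pose up (p : {poly K}) : {poly {poly K}} := map_poly polyC p.
have mapK (p : {poly K}) : map_poly (mmap polyC c) (map_poly (@mpolyC (n.+1 * d) K) p) = up p.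
  by rewrite -map_poly_comp; apply: eq_map_poly => a /=; rewrite mmapC.
pose U : 'rV[{poly K}]_(n.+1 * d) := map_mx polyC q + 'X *: map_mx polyC v.
have -> : map_mx (mmap polyC c) (\row_i 'X_i) = U.
  by apply/rowP => i; rewrite !mxE /= mmapX mmap1U.
have -> : tangent_det e (fun i => map_poly (mmap polyC c) (map_poly (@mpolyC (n.+1 * d) K) (lam i)))
    (map_poly (mmap polyC c) (map_poly (@mpolyC (n.+1 * d) K) (g j))) j U =
    tangent_det e (fun i => up (lam i)) (up (g j)) j U.
  by congr tangent_det; [apply/funext => i|]; rewrite mapK.
have UE i : rat_comp U i = up (rat_comp q i) + 'X *: up (rat_dir v i).
  by rewrite rat_compD /up map_rat_comp map_rat_dir.
rewrite /tangent_det; set b := combination _ _.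
have bE : b = up ('X - z%:P) + 'X *: up (combination lam (rat_dir v)).
  have -> : up ('X - z%:P) = combination (fun i => up (lam i)) (fun i => up (rat_comp q i)).
    rewrite /up -map_combination; congr map_poly.
    rewrite -[LHS]mulr1 -lam1 mulr_sumr; apply: eq_bigr => i _.
    by rewrite Eq mulrCA.
  rewrite /up map_combination scaler_sumr -big_split; apply: eq_bigr => i _ /=.
  by rewrite UE mulrDr scalerAr.
(* At q the combination is X - z by the Bezout identity, so the last row is the path parameter times
   [om]. The coefficient of order one is thus the determinant at q bordered by [om], nonzero unless
   om(z) = 0. *)
have -> : up (g j) * b - rat_comp U j = 'X *: up om.
  rewrite bE UE Eq /om /up !rmorphB !rmorphM /= -!mul_polyC rmorphB /=; ring.
rewrite bordered_detZ coefXM /= -horner_coef0 -[_.[0]]/(horner_eval 0 _) map_bordered_det.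
have downK (p : {poly K}) : map_poly (horner_eval 0) (up p) = p.
  by rewrite -map_poly_comp map_poly_id // => a _ /=; rewrite /horner_eval hornerC.
have down0 p r : map_poly (horner_eval 0) (up p + 'X *: up r) = p.
  by rewrite rmorphD /= downK linearZ /= downK /horner_eval hornerX scale0r addr0.
rewrite UE bE !down0 downK Eq => /eqP; apply: contraLR => omz.
have sV i : (size (rat_dir v i) <= d.+1)%N by rewrite (leq_trans (size_rat_dir _ _)).
apply: bordered_det_neq0 => //.
- by rewrite /e addn_gt0 d0 orbT.
- by rewrite size_g prednK.
exact: size_border.
Qed.

End TangentEquation.

(** * The theorem *)

Section Main.
Variable K : numClosedFieldType.

Lemma diff_map_comp_id N M (Phi : M.-tuple {mpoly K[N]}) (Psi : N.-tuple {mpoly K[M]}) x v :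
  (forall j, tnth Psi j \mPo Phi = 'X_j) ->
  diff_map Psi (poly_map Phi x) (diff_map Phi x v) = v.
Proof. by move=> E; apply/rowP => j; rewrite mxE -grad_comp E grad_X. Qed.

Lemma poly_map_comp_id N M (Phi : M.-tuple {mpoly K[N]}) (Psi : N.-tuple {mpoly K[M]}) x :
  (forall j, tnth Psi j \mPo Phi = 'X_j) -> poly_map Psi (poly_map Phi x) = x.
Proof. by move=> E; apply/rowP => j; rewrite mxE -meval_comp E mevalXU. Qed.

Lemma vanishes_comp N M (Phi : M.-tuple {mpoly K[N]}) (X : set 'rV[K]_N) (Y : set 'rV[K]_M) G :
  (forall x, X x -> Y (poly_map Phi x)) -> vanishes_on Y G -> vanishes_on X (G \mPo Phi).
Proof. by move=> XY GY x Xx; rewrite meval_comp GY //; apply: XY. Qed.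

Lemma generic_lines_in_Rat d n : (1 < d)%N -> (1 < n)%N -> generic_lines_in (Rat_var K d n).
Proof.
move=> d1 n1; exists (@rat_law d n); split; first exact: natural_rat_law.
  exact: rat_law_witness (ltnW d1) d1 n1.
by move=> x v /rat_law_neq0; apply; apply: ltnW.
Qed.

Lemma generic_lines_in_Poly m k : (1 < m)%N -> (2 < k)%N -> generic_lines_in (Poly_var K m k).
Proof.
move=> m1 k2; exists (@poly_law m); split; first exact: natural_poly_law.
  exact: poly_law_witness m1.
by move=> x v /poly_law_neq0; apply.
Qed.

Lemma row_killed_by_columns N m (A : 'M[K]_(m, N)) l : (l < m)%N -> (l <= N)%N ->
  exists2 y : 'rV_m, y != 0 & forall j : 'I_N, (j < l)%N -> (y *m A) 0 j = 0.
Proof.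
move=> lm lN; pose B := colsub (widen_ord lN) A.
have : kermx B != 0.
  rewrite -mxrank_eq0 mxrank_ker subn_eq0 -ltnNge.
  by rewrite (leq_ltn_trans (rank_leq_col _)).
move=> /rowV0Pn[y /sub_kermxP yB y0]; exists y => // j jl.
move/rowP/(_ (Ordinal jl)): yB; rewrite !mxE => yB; rewrite -[RHS]yB.
by apply: eq_bigr => i _; rewrite mxE; congr (_ * A _ _); apply: val_inj.
Qed.

Theorem not_isomorphic_Rat_Poly d n : (1 < d)%N -> (1 < n)%N ->
  ~ isomorphic (Rat_var K d n) (Poly_var K (d * n.+1) n.+1).
Proof.
move=> d1 n1 iso; set M := (d * n.+1)%N in iso *.
have nM : (n.+2 < M)%N by rewrite /M; nia.
have M1 : (1 < M)%N by lia.
have [Phi [Psi [PsiPhi PhiPsi RD DR]]] :=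
  isomorphic_poly_map (generic_lines_in_Rat d1 n1) (generic_lines_in_Poly M1 (n1 : (2 < n.+1)%N)) iso.
pose p := cusp K M n; pose q := poly_map Psi p.
have pq : poly_map Phi q = p := poly_map_comp_id p PhiPsi.
have Dp : ~ Poly_var K M n.+1 p.
  apply: (@cusp_in _ _ _ ('X * cusp_unit K M n) _ 0).
  by rewrite monic_poly_of_cusp // subr0 mulrA -exprSr.
have /contrapT[z qz] := DR _ Dp.
have /choice[g gE] : forall i, exists h, rat_comp q i = ('X - z%:P) * h.
  by move=> i; have /factor_theorem[h Eh] := qz i; exists h; rewrite mulrC -Eh.
have [[w gw]|nocommon] := pselect (exists w, forall i, root (g i) w).
  have /choice[h hE] : forall i, exists h, g i = ('X - w%:P) * h.
    by move=> i; have /factor_theorem[h ->] := gw i; exists h; rewrite mulrC.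
  have qE i : rat_comp q i = ('X - z%:P) * ('X - w%:P) * h i by rewrite gE hE mulrA.
  (* Every gradient vanishes at [q] in this case, whereas this equation pulls back to one with
     nonzero gradient there. *)
  have [F FD [v]] := @exists_grad_cusp_neq0 K M n n1 nM; case/eqP.
  rewrite -/p -[v](diff_map_comp_id p v PhiPsi) -/q -[X in grad F X]pq -grad_comp.
  have FR : vanishes_on (~` Rat_var K d n)%classic (F \mPo Phi).
    by apply: vanishes_comp FD => x; apply: RD.
  exact: (grad_double_common_factor d1 _ FR qE).
have [lam lam1] := bezout_family (fun w gw => nocommon (ex_intro _ w gw)).
have [j0 gj0] : exists j, (g j).[z] != 0.
  apply: contrapT => /forallNP H; apply: nocommon; exists z => j.
  by apply/negP => /negP /(H j).
(* Constants added to the components other than [j0] give n independent directions. Only the first n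
   - 1 coordinates can obstruct tangency at the cusp, so some nonzero combination is tangent. *)
pose E : 'M[K]_(n, n.+1 * d) :=
  \matrix_k rat_vec d (fun i => if i == lift j0 k then 1 else 0).
have rat_dir_E y i : rat_dir (y *m E) i = \sum_k y 0 k *: (if i == lift j0 k then 1 else 0).
  rewrite mulmx_sum_row /rat_dir !linear_sum /=; apply: eq_bigr => k _.
  rewrite !linearZ /= rowK; congr (_ *: _); rewrite -/(rat_dir _ _) rat_dir_vec //.
  by case: ifP; rewrite ?size_poly0 ?size_poly1 // ltnW.
pose J : 'M[K]_(n.+1 * d, M) := \matrix_(i, j) ((tnth Phi j)^`M(i)).@[q 0].
have nM1 : (n.-1 <= M)%N by lia.
have [y y0 yE] := @row_killed_by_columns _ _ (E *m J) n.-1 (ltac:(lia)) nM1.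
have Ev (G : {mpoly K[(n.+1 * d)]}) :
    vanishes_on (~` Rat_var K d n)%classic G -> grad G q (y *m E) = 0.
  move=> GR; rewrite -(diff_map_comp_id q (y *m E) PsiPhi) pq -grad_comp.
  apply: big1 => j _; have [jn|nj] := ltnP j n.-1.
    by rewrite diff_mapE -mulmxA yE // mul0r.
  have GD : vanishes_on (~` Poly_var K M n.+1)%classic (G \mPo Psi).
    by apply: vanishes_comp GR => x; apply: DR.
  by rewrite -grad_delta (grad_cusp_delta n1 nM GD) ?mulr0.
have tan := combination_tangent (ltnW d1) gE lam1 Ev.
(* The direction has component 0 at [j0] while (g j0)(z) is nonzero, so the common scalar is 0, and
   with it every coordinate of [y]. *)
move: (tan j0); rewrite rat_dir_E big1 ?horner0; last first.
  by move=> k _; rewrite (negPf (neq_lift _ _)) scaler0.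
move=> /esym/eqP; rewrite mulf_eq0 (negPf gj0) /= => /eqP beta0.
case/eqP: y0; apply/rowP => k; have := tan (lift j0 k).
rewrite beta0 mulr0 rat_dir_E (bigD1 k) //= eqxx big1 ?addr0; last first.
  by move=> l lk; rewrite (inj_eq lift_inj) eq_sym (negPf lk) scaler0.
by rewrite hornerZ hornerC mulr1 mxE.
Qed.

End Main.

Theorem theorem1p7 (R : realType) (d n : nat) (hd : (2 <= d)%N) (hn : (2 <= n)%N) :
  ~ isomorphic (Rat_var R[i] d n) (Poly_var R[i] (d * n.+1) n.+1).
Proof. exact: (@not_isomorphic_Rat_Poly R[i]). Qed.
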